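(* Let $0\le r\le3$ be an integer, $s\in[1,\infty]$ with conjugate exponent $s^*$, $\beta>0$ and $f\in\mathcal{DG}_r(\Omega_0)$. Then the (Fenchel) dual problem of $$\text{Minimize}\quad\sum_{T\subset\Omega_0}\int_T\mathcal J_T\{|u-f|\}\,dx+\beta\,|u|_{DTV(\Omega)}\quad\text{over }u\in\mathcal{DG}_r(\Omega)$$ is $$\begin{aligned}\text{Minimize}\quad&\int_{\Omega_0}(\operatorname{div}p)\,f\,dx\quad\text{over }p\in\mathcal{RT}^0_{r+1}(\Omega)\\ \text{s.t.}\quad&\Big|\int_T(\operatorname{div}p)\,\Phi_{T,k}\,dx\Big|\le C_{T,k}\ \text{ for all }k\text{ when }T\subset\Omega_0,\\ \text{and}\quad&\Big|\int_T(\operatorname{div}p)\,\Phi_{T,k}\,dx\Big|=0\ \text{ for all }k\text{ when }T\subset\Omega\setminus\Omega_0,\\ \text{and}\quad&p\in\beta\,\mathbf P,\end{aligned}$$ where $$\beta\,\mathbf P=\big\{p\in\mathcal{RT}^0_{r+1}(\Omega):\ |\sigma_{T,i}(p)|_{s^*}\le\beta\,c_{T,i}\text{ for all }T\text{ and all }i,\ |\sigma_{E,j}(p)|\le\beta\,|n_E|_s\,c_{E,j}\text{ for all }E\text{ and all }j\big\}.$$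
   Context: $\Omega\subset\mathbb R^2$ is a bounded domain with polygonal boundary, triangulated by a geometrically conforming mesh (no hanging nodes) of non-degenerate triangles $T$; $E$ ranges over the interior edges. $\Omega_0\subset\Omega$ (where data is available) is such that $\Omega\setminus\Omega_0$ is a union of triangles of the mesh (possibly empty). On each interior edge $E$, $n_E$ is a fixed normal vector of unit Euclidean length with arbitrary orientation. $|\cdot|_s$ is the $\ell^s$-norm on $\mathbb R^2$. $P_m(T)$ (resp. $P_m(E)$) denotes polynomials of total degree at most $m$ on $T$ (resp. univariate polynomials of degree at most $m$ on $E$); $P_{-1}=\{0\}$. $\mathcal{DG}_r(\Omega)=\{u\in L^2(\Omega): u|_T\in P_r(T)\text{ for all }T\}$, and $\mathcal{DG}_r(\Omega_0)$ is defined likewise using the triangles in $\Omega_0$. All nodal (Lagrange) bases on triangles use nodes forming the uniform lattice on $T$ (the barycenter for degree $0$); nodes on edges are equispaced including end points (the midpoint for degree $0$). $\Phi_{T,k}$, $k=1,\dots,(r+1)(r+2)/2$, is the standard nodal basis of $P_r(T)$ with nodes $Z_{T,k}$; $\varphi_{T,i}$, $i=1,\dots,r(r+1)/2$, that of $P_{r-1}(T)$ with nodes $X_{T,i}$ (no such indices if $r=0$); $\varphi_{E,j}$, $j=1,\dots,r+1$, that of $P_r(E)$ with nodes $X_{E,j}$. Interpolation: $\mathcal J_T\{v\}=\sum_kv(Z_{T,k})\Phi_{T,k}$ (values taken from within $T$), $\mathcal I_T\{v\}=\sum_iv(X_{T,i})\varphi_{T,i}$, $\mathcal I_E\{v\}=\sum_jv(X_{E,j})\varphi_{E,j}$.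 Weights: $C_{T,k}=\int_T\Phi_{T,k}\,dx$, $c_{T,i}=\int_T\varphi_{T,i}\,dx$, $c_{E,j}=\int_E\varphi_{E,j}\,dS$. For an interior edge $E$ between $T_1,T_2$ with outer unit normals $n_1,n_2=-n_1$ along $E$, $[\![u]\!]_E=(u|_{T_1}n_1+u|_{T_2}n_2)\cdot n_E\in P_r(E)$. The discrete TV-seminorm is $|u|_{DTV(\Omega)}=\sum_T\int_T\mathcal I_T\{|\nabla u|_s\}\,dx+\sum_E\int_E\mathcal I_E\{|[\![u]\!]_E|\,|n_E|_s\}\,dS$. $\mathcal{RT}_{r+1}(\Omega)=\{p\in H(\operatorname{div};\Omega): p|_T\in P_r(T)^2+x\,P_r(T)\ \forall T\}$ and $\mathcal{RT}^0_{r+1}(\Omega)$ is the subspace with $p\cdot n=0$ on $\partial\Omega$. Its degrees of freedom are $\sigma_{T,i}(p)=\int_T\varphi_{T,i}\,p\,dx\in\mathbb R^2$ and $\sigma_{E,j}(p)=\int_E\varphi_{E,j}(p\cdot n_E)\,dS$; they uniquely determine $p\in\mathcal{RT}^0_{r+1}(\Omega)$ and may be prescribed arbitrarily. Meaning of ''dual problem''. Put $U=\mathcal{DG}_r(\Omega)$, $Y=\prod_TP_{r-1}(T)^2\times\prod_EP_r(E)$, $\Lambda:U\to Y$, $(\Lambda u)_T=\nabla u|_T$, $(\Lambda u)_E=[\![u]\!]_E$, $G(d)=\sum_T\int_T\mathcal I_T\{|d_T|_s\}\,dx+\sum_E|n_E|_s\int_E\mathcal I_E\{|d_E|\}\,dS$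 for $d\in Y$, and $F(u)=\sum_{T\subset\Omega_0}\int_T\mathcal J_T\{|u-f|\}\,dx$, so the primal objective is $F(u)+\beta G(\Lambda u)$. The dual space $Y^*$ is identified with $\mathcal{RT}^0_{r+1}(\Omega)$ via $\langle p,d\rangle=\sum_T\int_Tp\cdot d_T\,dx+\sum_E\int_E(p\cdot n_E)\,d_E\,dS$. The dual problem is to minimize over $p\in\mathcal{RT}^0_{r+1}(\Omega)$ the function $$D(p)=F^*(-\Lambda^*p)+\beta G^*(p/\beta)=\sup_{u\in U}\big(-\langle p,\Lambda u\rangle-F(u)\big)+\sup_{d\in Y}\big(\langle p,d\rangle-\beta G(d)\big)\in(-\infty,\infty].$$ Saying that the dual problem is ''minimize $J(p)$ subject to $p\in S$'' means that $D=J$ on $S$ and $D=+\infty$ outside $S$.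
   Formalization: The edge term identifying Y* with RT^0 is given a minus sign, <p,d> = sum_T int p.d_T - sum_E int (p.n_E) d_E; with the plus sign and outer-normal jumps, -Lambda* is not the divergence and the claim fails (e.g. r=0, two triangles, f=1 on one and 0 on the other). *)

(* Defs.v *)
From HB Require Import structures.
From mathcomp Require Import all_boot all_order all_algebra.
From mathcomp Require Import all_classical all_reals all_analysis.
From mathcomp Require Import ring lra.
Import Order.TTheory GRing.Theory Num.Theory numFieldNormedType.Exports.
Set Implicit Arguments.
Unset Strict Implicit.
Unset Printing Implicit Defensive.
Local Open Scope classical_set_scope.
Local Open Scope ring_scope.

Section Plane.
Context {R : realType}.
Implicit Types (a b x y : R * R) (f g : R * R -> R) (n : nat).

Definition area := (@lebesgue_measure R \x @lebesgue_measure R)%E.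

Definition dot x y : R := x.1 * y.1 + x.2 * y.2.
Definition det2 x y : R := x.1 * y.2 - x.2 * y.1.
Definition enorm x : R := Num.sqrt (dot x x).

(* The l^s norm; only meaningful for s in [1, +oo]. *)
Definition lnorm (s : \bar R) x : R :=
  if s is q%:E then (`|x.1| `^ q + `|x.2| `^ q) `^ q^-1
  else Num.max `|x.1| `|x.2|.

Definition seg a b : set (R * R) := [set a + t *: (b - a) | t in `[0, 1]].

Definition bnd (A : set (R * R)) : set (R * R) := closure A `\` interior A.

Definition grad f x : R * R := ('D_(1, 0) f x, 'D_(0, 1) f x).
Definition divergence (p : R * R -> R * R) x : R :=
  'D_(1, 0) (fun y => (p y).1) x + 'D_(0, 1) (fun y => (p y).2) x.

(* Polynomials of total degree < n, so that P_m is [Pol m.+1] for every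
   m >= -1; in particular P_{-1} = [Pol 0] = {0}. *)
Definition Pol n f : Prop :=
  exists c : nat -> nat -> R, forall x,
    f x = \sum_(i < n) \sum_(j < n - i) c i j * x.1 ^+ i * x.2 ^+ j.

Definition Polvec n (p : R * R -> R * R) : Prop :=
  Pol n (fun x => (p x).1) /\ Pol n (fun x => (p x).2).

(* The local Raviart-Thomas space P_m^2 + x P_m, with n = m + 1. *)
Definition RTloc n (p : R * R -> R * R) : Prop :=
  exists q g, [/\ Polvec n q, Pol n g & forall x, p x = q x + g x *: x].

Definition lineint a b f : R :=
  enorm (b - a) * \int[lebesgue_measure]_(t in `[0, 1]) f (a + t *: (b - a)).

(* Continuously differentiable functions with compact support in W. *)
Definition C1c (W : set (R * R)) f : Prop :=
  [/\ forall x, differentiable f x,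
      forall w : R * R, continuous ('D_w f)
    & exists K, [/\ compact K, K `<=` W & forall x, ~ K x -> f x = 0]].

End Plane.

Record mesh (R : realType) :=
  Mesh { ntri : nat; vtx : 'I_ntri -> 'I_3 -> R * R }.

Section Mesh.
Context {R : realType} (M : mesh R).
Local Notation cell := 'I_(ntri M).
Implicit Types (T : cell) (f : R * R -> R) (x : R * R).

Definition tri T : set (R * R) :=
  [set x | exists l : 'I_3 -> R,
     [/\ forall i, 0 <= l i, \sum_i l i = 1 & x = \sum_i l i *: vtx T i]].

Definition intT T f : R := \int[area]_(x in tri T) f x.

(* A side is a triangle together with the local number of the vertex opposite
   to the side; local numbers are read modulo 3. *)
Definition side := (cell * 'I_3)%type.
Definition sa (e : side) : R * R := vtx e.1 (e.2 + 1).
Definition sb (e : side) : R * R := vtx e.1 (e.2 + 2%:R).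
Definition sopp (e : side) : R * R := vtx e.1 e.2.
Definition sseg (e : side) : set (R * R) := seg (sa e) (sb e).

(* The unit normal pointing out of the triangle, that is, away from the
   opposite vertex. *)
Definition onormal (e : side) : R * R :=
  let t := sb e - sa e in
  let w := (enorm t)^-1 *: (t.2, - t.1) in
  - Num.sg (dot w (sopp e - sa e)) *: w.

Definition triangulates (Omega : set (R * R)) : Prop :=
  [/\ forall T, det2 (vtx T 1 - vtx T 0) (vtx T 2%:R - vtx T 0) != 0,
      closure Omega = \bigcup_(T in setT) tri T,
      (* the boundary is polygonal and resolved by the mesh *)
      exists B : {set side}, bnd Omega = \bigcup_(e in [set` B]) sseg e
    & (* no hanging nodes *)
      forall T T' : cell, T != T' ->
      [\/ tri T `&` tri T' = set0,
          exists i j, vtx T i = vtx T' j /\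
            tri T `&` tri T' = [set vtx T i]
        | exists i j, sseg (T, i) = sseg (T', j) /\
            tri T `&` tri T' = sseg (T, i)]].

(* An interior edge is given by the two sides of which it consists, the side
   of the triangle of smaller index coming first so that each edge occurs
   exactly once. The point set of the edge is [sseg e.1]. *)
Definition edge := (side * side)%type.

Definition same_ends (e e' : side) : bool :=
  ((sa e == sa e') && (sb e == sb e')) || ((sa e == sb e') && (sb e == sa e')).

Definition iedges (Omega : set (R * R)) : {set edge} :=
  [set e : edge | [&& (e.1.1 < e.2.1)%N, same_ends e.1 e.2
                    & ~~ `[< sseg e.1 `<=` bnd Omega >]]]%SET.

Definition intE (e : edge) f : R := lineint (sa e.1) (sb e.1) f.

(* Univariate polynomials of degree < n on an edge. *)
Definition PolE n (e : edge) f : Prop :=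
  exists q : {poly R}, (size q <= n)%N /\
    forall t, 0 <= t <= 1 -> f (sa e.1 + t *: (sb e.1 - sa e.1)) = q.[t].

Definition bary T (i : 'I_3) x : R :=
  det2 (x - sa (T, i)) (sb (T, i) - sa (T, i))
  / det2 (sopp (T, i) - sa (T, i)) (sb (T, i) - sa (T, i)).

(* The uniform lattice with n points on every side, which is unisolvent for
   polynomials of degree n - 1. Its points are indexed by the triples of
   natural numbers with sum n - 1, the last entry being implicit. There are
   n (n + 1) / 2 of them, hence none if n = 0. *)
Definition lat n := {k : 'I_n * 'I_n | (k.1 + k.2 < n)%N}.

Definition lat3 n (k : lat n) (l : 'I_3) : nat :=
  nth 0%N [:: ((val k).1 : nat); ((val k).2 : nat);
              (n.-1 - (val k).1 - (val k).2)%N] l.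

Definition node T n (k : lat n) : R * R :=
  \sum_(l < 3)
    (if n == 1 then 3^-1 else (lat3 k l)%:R / n.-1%:R) *: vtx T l.

Definition basis T n (k : lat n) x : R :=
  \prod_(l < 3) \prod_(a < lat3 k l)
    ((n.-1%:R * bary T l x - a%:R) / ((lat3 k l)%:R - a%:R)).

Definition interp T n f x : R := \sum_(k : lat n) f (node T k) * basis T k x.

Definition ecoord (e : edge) x : R :=
  dot (x - sa e.1) (sb e.1 - sa e.1)
  / dot (sb e.1 - sa e.1) (sb e.1 - sa e.1).

Definition enode (e : edge) n (j : 'I_n) : R * R :=
  sa e.1 + (if n == 1 then 2^-1 else j%:R / n.-1%:R) *: (sb e.1 - sa e.1).

Definition ebasis (e : edge) n (j : 'I_n) x : R :=
  \prod_(l < n | l != j) ((n.-1%:R * ecoord e x - l%:R) / (j%:R - l%:R)).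

Definition einterp (e : edge) n f x : R :=
  \sum_(j < n) f (enode e j) * ebasis e j x.

Lemma sum_lat3 n (k : lat n) : (\sum_(l < 3) lat3 k l = n.-1)%N.
Proof.
case: k => -[i j] /= kn; rewrite !big_ord_recl big_ord0 /lat3 /=.
have : (i + j <= n.-1)%N by rewrite -ltnS prednK // (leq_ltn_trans _ kn).
by move=> ijn; rewrite addn0 addnA -subnDA subnKC.
Qed.

Lemma lat3_inj n (k k' : lat n) : lat3 k =1 lat3 k' -> k = k'.
Proof.
move=> kk'; apply/val_inj; move: (kk' 0) (kk' 1); rewrite /lat3 /=.
by case: (val k) (val k') => [i j] [i' j'] /= /ord_inj -> /ord_inj ->.
Qed.

Lemma bary_comb T (w : 'I_3 -> R) (l : 'I_3) :
  det2 (vtx T 1 - vtx T 0) (vtx T 2%:R - vtx T 0) != 0 ->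
  \sum_i w i = 1 -> bary T l (\sum_i w i *: vtx T i) = w l.
Proof.
have e0 : ord0 = 0 :> 'I_3 by apply/val_inj.
have e1 : lift ord0 ord0 = 1 :> 'I_3 by apply/val_inj.
have e2 : lift ord0 (lift ord0 ord0) = 2%:R :> 'I_3 by apply/val_inj.
rewrite !big_ord_recl !big_ord0 !addr0 e2 e1 e0 => hd hw.
have : [\/ l = 0, l = 1 | l = 2%:R].
  by case: l => -[|[|[|//]]] il;
    [apply: Or31|apply: Or32|apply: Or33]; apply/val_inj.
have a01 : 0 + 1 = 1 :> 'I_3 by apply/val_inj.
have a02 : 0 + 2%:R = 2%:R :> 'I_3 by apply/val_inj.
have a11 : 1 + 1 = 2%:R :> 'I_3 by apply/val_inj.
have a12 : 1 + 2%:R = 0 :> 'I_3 by apply/val_inj.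
have a21 : 2%:R + 1 = 0 :> 'I_3 by apply/val_inj.
have a22 : 2%:R + 2%:R = 1 :> 'I_3 by apply/val_inj.
have {hw} hw : w 0 = 1 - w 1 - w 2%:R by rewrite -hw; ring.
case=> ->; rewrite /bary /sa /sb /sopp /=
  ?a01 ?a02 ?a11 ?a12 ?a21 ?a22 /= ?hw; move: hd;
  case: (vtx T 0) (vtx T 1) (vtx T 2%:R) => [x0 y0] [x1 y1] [x2 y2];
  rewrite /det2 /= /GRing.scale /= => hd;
  field; move: hd; apply: contra => /eqP h; apply/eqP; lra.
Qed.

Lemma bary_node T n (k : lat n) (l : 'I_3) :
  det2 (vtx T 1 - vtx T 0) (vtx T 2%:R - vtx T 0) != 0 ->
  n.-1%:R * bary T l (node T k) = (lat3 k l)%:R.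
Proof.
move=> hd; have := sum_lat3 k; rewrite /node; case: (n =P 1%N) => [n1 | n1 hs].
  have -> : n.-1 = 0%N by rewrite n1.
  move=> /eqP; rewrite sum_nat_eq0 => /forallP /(_ l) /= /eqP ->.
  by rewrite mul0r.
have n0 : n.-1%:R != 0 :> R.
  by rewrite pnatr_eq0; case: n k n1 {hs} => [[[[]//]]|[]].
rewrite (bary_comb (w := fun l => (lat3 k l)%:R / n.-1%:R)) //.
  by rewrite mulrC divfK.
by rewrite -mulr_suml -natr_sum hs divff.
Qed.

(* The defining property of the nodal basis of P_(n-1)(T). *)
Lemma basis_node T n (k k' : lat n) :
  det2 (vtx T 1 - vtx T 0) (vtx T 2%:R - vtx T 0) != 0 ->
  basis T k (node T k') = (k == k')%:R.
Proof.
move=> hd; rewrite /basis; have [<-|kk'] := eqVneq k k'.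
  rewrite big1 // => l _; rewrite big1 // => a _.
  rewrite bary_node // divff // subr_eq0 eqr_nat.
  by rewrite gtn_eqF // ltn_ord.
have [l hl] : exists l, (lat3 k' l < lat3 k l)%N.
  apply/existsP; apply: contraR kk'; rewrite negb_exists => /forallP h.
  apply/eqP/lat3_inj => l; apply/eqP.
  have le i : (lat3 k i <= lat3 k' i)%N by rewrite leqNgt h.
  have := sum_lat3 k'; rewrite -(sum_lat3 k) => /esym/eqP.
  have /leqif_sum := fun i (_ : true) =>
    (conj (le i) (erefl (lat3 k i == lat3 k' i)) :
      (lat3 k i <= lat3 k' i ?= iff (lat3 k i == lat3 k' i))%N).
  by move=> [_ ->] /forallP /(_ l).
rewrite (bigD1 l) //= (bigD1 (Ordinal hl)) //= bary_node //.
by rewrite subrr !mul0r.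
Qed.

Lemma ebasis_enode (e : edge) n (j j' : 'I_n) :
  sa e.1 != sb e.1 -> ebasis e j (enode e j') = (j == j')%:R.
Proof.
move=> hab; rewrite /ebasis.
have [n1|n1] := eqVneq n 1%N.
  move: j j'; rewrite n1 => j j'; rewrite !ord1 eqxx big1 // => l.
  by rewrite ord1 eqxx.
have n0 : n.-1%:R != 0 :> R by rewrite pnatr_eq0; case: n n1 j j' => [_ []|[]].
have -> : n.-1%:R * ecoord e (enode e j') = j'%:R.
  rewrite /ecoord /enode (negPf n1).
  move: hab; case: (sa e.1) (sb e.1) => [a1 a2] [b1 b2].
  rewrite /dot /= /GRing.scale /= => hab; field; rewrite n0 /= andbT.
  apply: contra hab => /eqP h.
  have h0 : (b1 - a1) ^+ 2 + (b2 - a2) ^+ 2 = 0 by rewrite !expr2.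
  have /andP[] : ((b1 - a1) ^+ 2 == 0) && ((b2 - a2) ^+ 2 == 0).
    by rewrite -paddr_eq0 ?sqr_ge0 // h0 eqxx.
  by rewrite !sqrf_eq0 !subr_eq0 => /eqP -> /eqP ->.
have [<-|jj'] := eqVneq j j'.
  by rewrite big1 // => l lj; rewrite divff // subr_eq0 eqr_nat eq_sym.
by rewrite (bigD1 j') 1?eq_sym //= subrr !mul0r.
Qed.

(* A function which is polynomial on every triangle is represented by the
   family of these polynomials, defined on the whole plane; in particular its
   traces on an edge are those of the two polynomials. Integrals of such
   functions over unions of triangles are sums over the triangles. *)
Definition DG n (u : cell -> R * R -> R) : Prop := forall T, Pol n (u T).
Definition DGon (D : {set cell}) n (u : cell -> R * R -> R) : Prop :=
  forall T, T \in D -> Pol n (u T).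

(* The weak divergence is a function g in L^2. That p itself is in L^2 is
   automatic for piecewise polynomials on a bounded domain. *)
Definition Hdiv (Omega : set (R * R)) (p : cell -> R * R -> R * R) : Prop :=
  exists g : R * R -> R,
    [/\ measurable_fun Omega g,
        area.-integrable Omega (fun x => (g x ^+ 2)%:E)
      & forall f, C1c Omega f ->
          \sum_T intT T (fun x => dot (p T x) (grad f x))
          = - \int[area]_(x in Omega) (g x * f x)].

Definition RT n (Omega : set (R * R)) (p : cell -> R * R -> R * R) : Prop :=
  (forall T, RTloc n (p T)) /\ Hdiv Omega p.

Definition RT0 n (Omega : set (R * R)) (p : cell -> R * R -> R * R) : Prop :=
  RT n Omega p /\
  forall (e : side) x, sseg e `<=` bnd Omega -> sseg e x ->
    dot (p e.1 x) (onormal e) = 0.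

(* Degrees of freedom. For p in H(div) the normal component is single-valued
   on e, so that its trace may be taken from the first triangle. *)
Definition ntrace (nE : edge -> R * R) (p : cell -> R * R -> R * R)
    (e : edge) x : R := dot (p e.1.1 x) (nE e).

Definition sigmaT n (p : cell -> R * R -> R * R) T (i : lat n) : R * R :=
  (intT T (fun x => basis T i x * (p T x).1),
   intT T (fun x => basis T i x * (p T x).2)).

Definition sigmaE n nE (p : cell -> R * R -> R * R) (e : edge) (j : 'I_n) : R :=
  intE e (fun x => ebasis e j x * ntrace nE p e x).

Definition wT n T (k : lat n) : R := intT T (basis T k).
Definition wE n (e : edge) (j : 'I_n) : R := intE e (ebasis e j).

Definition edge_normals (Omega : set (R * R)) (nE : edge -> R * R) : Prop :=
  forall e, e \in iedges Omega ->
    enorm (nE e) = 1 /\ dot (nE e) (sb e.1 - sa e.1) = 0.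

Definition jump (nE : edge -> R * R) (u : cell -> R * R -> R) (e : edge) x : R :=
  dot (u e.1.1 x *: onormal e.1 + u e.2.1 x *: onormal e.2) (nE e).

Section Problem.
Context (Omega : set (R * R)) (D0 : {set cell}) (nE : edge -> R * R).
Context (r : nat) (s : \bar R) (beta : R) (f : cell -> R * R -> R).

Definition DTV (u : cell -> R * R -> R) : R :=
  \sum_T intT T (interp T r (fun x => lnorm s (grad (u T) x)))
  + \sum_(e in iedges Omega)
      intE e (einterp e r.+1 (fun x => `|jump nE u e x| * lnorm s (nE e))).

Definition fidelity (u : cell -> R * R -> R) : R :=
  \sum_(T in D0) intT T (interp T r.+1 (fun x => `|u T x - f T x|)).

Definition primal_obj (u : cell -> R * R -> R) : R := fidelity u + beta * DTV u.

Definition dual_data : Type :=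
  ((cell -> R * R -> R * R) * (edge -> R * R -> R))%type.

Definition Yspace (d : dual_data) : Prop :=
  (forall T, Polvec r (d.1 T)) /\
  (forall e, e \in iedges Omega -> PolE r.+1 e (d.2 e)).

Definition Lam (u : cell -> R * R -> R) : dual_data :=
  (fun T => grad (u T), jump nE u).

Definition Gfun (d : dual_data) : R :=
  \sum_T intT T (interp T r (fun x => lnorm s (d.1 T x)))
  + \sum_(e in iedges Omega)
      lnorm s (nE e) * intE e (einterp e r.+1 (fun x => `|d.2 e x|)).

(* The identification of the dual of Y with the Raviart-Thomas space. The
   jumps being formed with outer normals, integration by parts on every
   triangle gives, for p in RT0 and u in DG,
     sum_T int_T (div p) u =
       - sum_T int_T p . grad u + sum_E int_E (p . n_E) [[u]],
   so the minus sign is what makes - Lam^* the divergence. *)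
Definition pairing (p : cell -> R * R -> R * R) (d : dual_data) : R :=
  \sum_T intT T (fun x => dot (p T x) (d.1 T x))
  - \sum_(e in iedges Omega) intE e (fun x => ntrace nE p e x * d.2 e x).

(* The convex conjugate of F : V -> R, with effective domain A, at the
   linear form xi. *)
Definition fconj (V : Type) (A : set V) (F xi : V -> R) : \bar R :=
  ereal_sup [set (xi v - F v)%:E | v in A].

(* F^*(- Lam^* p) + (beta G)^*(p) *)
Definition dual_obj (p : cell -> R * R -> R * R) : \bar R :=
  (fconj [set u | DG r.+1 u] fidelity (fun u => - pairing p (Lam u))%R
   + fconj [set d | Yspace d] (fun d => beta * Gfun d)%R (pairing p))%E.

Definition div_int (p : cell -> R * R -> R * R) T (k : lat r.+1) : R :=
  intT T (fun x => divergence (p T) x * basis T k x).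

Definition dual_J (p : cell -> R * R -> R * R) : R :=
  \sum_(T in D0) intT T (fun x => divergence (p T) x * f T x).

Definition betaP (p : cell -> R * R -> R * R) : Prop :=
  [/\ RT0 r.+1 Omega p,
      forall T (i : lat r),
        lnorm (hoelder_conjugate s) (sigmaT p T i) <= beta * wT T i
    & forall e (j : 'I_r.+1), e \in iedges Omega ->
        `|sigmaE nE p e j| <= beta * lnorm s (nE e) * wE e j].

Definition dual_feasible (p : cell -> R * R -> R * R) : Prop :=
  [/\ forall T (k : lat r.+1), T \in D0 -> `|div_int p T k| <= wT T k,
      forall T (k : lat r.+1), T \notin D0 -> `|div_int p T k| = 0
    & betaP p].

End Problem.
End Mesh.

(* Main.v *)
Require Import Defs.
From HB Require Import structures.
From mathcomp Require Import all_boot all_order all_algebra.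
From mathcomp Require Import all_classical all_reals all_analysis.
From mathcomp Require Import measurable_realfun.
From mathcomp Require Import ring lra zify.
Import Order.TTheory GRing.Theory Num.Theory numFieldNormedType.Exports.
Set Implicit Arguments.
Unset Strict Implicit.
Unset Printing Implicit Defensive.
Local Open Scope classical_set_scope.
Local Open Scope ring_scope.

(** Everything decouples over nodes once two facts are known.

    The first is integration by parts: for p in RT0 and u piecewise polynomial,
    - <p, Lambda u> = sum_T int_T (div p) u (pairing_Lam). The divergence theorem
    on each triangle (Green_tri) leaves the integrals of u (p . n) over all the
    sides. Sides in the boundary of Omega contribute nothing since p . n vanishes
    there. On any other side the outward fluxes of p from the triangles at that
    side cancel (flux_eq0). This is where p in H(div) enters: the weak divergence
    is tested with functions whose supports shrink to the side while their values
    on the side stay fixed, so that the volume integrals tend to zero by dominated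
    convergence and only the flux remains. A side off the boundary belongs to at
    most two triangles, which lie on opposite sides of it, because otherwise two
    triangles would overlap in more than a common side or vertex
    (same_ends_opposite, partner_unique). Hence the remaining terms pair up into
    the integrals of (p . n_E) [[u]] over the interior edges.

    The second is that polynomials coincide with their Lagrange interpolants
    (interp_id, einterp_id). So the integrals against p become sums over the nodes
    in which the degrees of freedom of p, or the moments of div p against the
    nodal basis, multiply arbitrary nodal values, and the functionals F and G are
    weighted sums of norms of the same nodal values (fidelity_nodal,
    pairing_nodal).

    The conjugates are then suprema over independent nodal values v of terms
    a v - c |v - v_0| or sigma . v - c |v|_s. Such a supremum equals a v_0,
    respectively 0, if |a| <= c, respectively |sigma|_{s^*} <= c, by the Hoelder
    inequality, and is infinite otherwise, since that inequality is sharp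
    (lnorm_dual). Adding the terms a v_0 gives the integral of (div p) f over
    Omega_0; on triangles outside Omega_0 the weight c is zero, which forces the
    moments of div p to vanish. *)

(** * Affine maps of the plane and area *)

Section AffineArea.
Context {R : realType}.
Local Notation leb := (@lebesgue_measure R).
Local Notation area := (@area R).

(** Turns an identity between vectors into polynomial identities between their
    coordinates. *)
Lemma planeE :
  (forall x y : R * R, (x + y).1 = x.1 + y.1) *
  (forall x y : R * R, (x + y).2 = x.2 + y.2) *
  (forall x : R * R, (- x).1 = - x.1) * (forall x : R * R, (- x).2 = - x.2) *
  (forall (c : R) (x : R * R), (c *: x).1 = c * x.1) *
  (forall (c : R) (x : R * R), (c *: x).2 = c * x.2).
Proof. by []. Qed.

Lemma measurable_affine1 (d k : R) :
  measurable_fun [set: measurableTypeR R]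
    (fun y : measurableTypeR R => d * y + k : measurableTypeR R).
Proof.
by apply: measurable_funD => //; apply: measurable_funM.
Qed.

(** Both sides are measures in B that agree on half-open intervals. *)
Lemma lebesgue_affine (d k : R) (B : set (measurableTypeR R)) :
  d != 0 -> measurable B ->
  (`|d|%:E * leb ((fun y => (d * y + k)%R) @^-1` B) = leb B)%E.
Proof.
move=> d0 mB.
have mphi := measurable_affine1 d k.
pose push := measure_function_pushforward__canonical__measure_function_Measure leb mphi.
pose m := mscale (NngNum (normr_ge0 d)) push.
rewrite [RHS](@lebesgue_measure_unique _ m) // => X /ocitvP[->|[[a b] /= ab ->]].
  by rewrite !measure0.
rewrite /m /mscale /= /pushforward.
rewrite lebesgue_measure_itv /= lte_fin ab.
have [d0'|d0'] := ltP 0 d.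
  have -> : (fun y => d * y + k) @^-1` `]a, b] = `](a - k) / d, (b - k) / d]%classic.
    apply/seteqP; split => y /=; rewrite !in_itv /= ltr_pdivrMr //
      ler_pdivlMr // ltrBlDr lerBrDr mulrC //.
  rewrite lebesgue_measure_itv /= lte_fin ltr_pM2r ?invr_gt0 // ltrD2r ab.
  rewrite -!EFinB -EFinM; congr (_%:E); rewrite gtr0_norm //; field; lra.
have {d0 d0'} d0 : d < 0 by rewrite lt_neqAle d0.
have -> : (fun y => d * y + k) @^-1` `]a, b] = `[(b - k) / d, (a - k) / d[%classic.
  by apply/seteqP; split => y /=; rewrite !in_itv /= ltr_ndivlMr //
    ler_ndivrMr // ltrBlDr lerBrDr (mulrC y) andbC.
rewrite lebesgue_measure_itv /= lte_fin ltr_nM2r ?invr_lt0 // ltrD2r ab.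
rewrite -!EFinB -EFinM; congr (_%:E); rewrite ltr0_norm //; field; lra.
Qed.

Lemma measurable_shear (c d k : R) :
  measurable_fun [set: measurableTypeR R * measurableTypeR R]
    (fun x : measurableTypeR R * measurableTypeR R =>
      (x.1, (c * x.1 + d * x.2 + k)%R) : measurableTypeR R * measurableTypeR R).
Proof.
apply/measurable_fun_pair => //.
by apply: measurable_funD => //; apply: measurable_funD;
  apply: measurable_funM.
Qed.

(** On each vertical line the map is an affine map of the line with slope d. *)
Lemma area_shear (c d k : R) (B : set (measurableTypeR R * measurableTypeR R)) :
  d != 0 -> measurable B ->
  (`|d|%:E * area ((fun x => (x.1, c * x.1 + d * x.2 + k)%R) @^-1` B) = area B)%E.
Proof.
move=> d0 mB; rewrite /area /product_measure1 -ge0_integralZl //; last first.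
  apply: measurable_fun_xsection.
  rewrite -[X in measurable X]setTI; exact: measurable_shear.
apply: eq_integral => x _ /=.
rewrite -(@lebesgue_affine d (c * x + k) _ d0 (measurable_xsection x mB)).
congr (_ * leb _)%E; apply/funext => y /=; apply/propext.
rewrite /xsection /= !inE /=.
by have -> : c * x + d * y + k = d * y + (c * x + k) by ring.
Qed.

Lemma area_swap (B : set (measurableTypeR R * measurableTypeR R)) :
  measurable B -> area (unstable.swap @^-1` B) = area B.
Proof.
move=> mB.
pose push := measure_function_pushforward__canonical__measure_function_Measure area
  (measurable_swap (T1 := measurableTypeR R) (T2 := measurableTypeR R)).
rewrite {2}/area (@product_measure_unique _ _ _ _ _ leb leb push) //.
move=> A A' mA mA'; rewrite /push /= /pushforward.
have -> : unstable.swap @^-1` (A `*` A') = A' `*` A.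
  by apply/seteqP; split => -[x y] [].
by rewrite [LHS]product_measure1E // muleC.
Qed.

(** Stated with preimages, so that it composes and combines with the formula for
    integrals with respect to image measures. *)
Definition scales_area (phi : measurableTypeR R * measurableTypeR R ->
    measurableTypeR R * measurableTypeR R) (m : R) : Prop :=
  measurable_fun setT phi /\ forall B, measurable B -> (m%:E * area (phi @^-1` B) = area B)%E.

Lemma scales_area_comp phi psi m m' : scales_area phi m -> scales_area psi m' ->
  scales_area (phi \o psi) (m' * m).
Proof.
move=> [mphi hphi] [mpsi hpsi]; split; first exact: measurableT_comp.
move=> B mB; rewrite comp_preimage EFinM -muleA (muleCA m'%:E) hpsi ?hphi //.
by rewrite -[X in measurable X]setTI; exact: mphi.
Qed.

Lemma scales_area_shear c d k : d != 0 ->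
  scales_area (fun x => (x.1, c * x.1 + d * x.2 + k)) `|d|.
Proof.
by move=> d0; split; [exact: measurable_shear|move=> B; exact: area_shear].
Qed.

Lemma scales_area_swap : scales_area (@unstable.swap _ _) 1.
Proof.
by split; [exact: measurable_swap|move=> B mB; rewrite mul1e area_swap].
Qed.

(* v + x.1 a + x.2 b *)
Definition affine2 (v a b : R * R) (x : R * R) : R * R :=
  v + (x.1 *: a + x.2 *: b).

Lemma affine2E v a b x : affine2 v a b x =
  (v.1 + (x.1 * a.1 + x.2 * b.1), v.2 + (x.1 * a.2 + x.2 * b.2)).
Proof. by []. Qed.

(** An invertible affine map is a product of coordinate swaps and of the maps of
    area_shear. This needs a nonzero first entry of a, which a swap provides. *)
Lemma scales_area_affine2 v a b : det2 a b != 0 ->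
  scales_area (affine2 v a b) `|det2 a b|.
Proof.
move: v a b => [v1 v2].
have key a1 a2 b1 b2 : a1 != 0 -> a1 * b2 - a2 * b1 != 0 ->
    scales_area (affine2 (v1, v2) (a1, a2) (b1, b2)) `|a1 * b2 - a2 * b1|.
  move=> a0 d0.
  set d := a1 * b2 - a2 * b1 in d0 *.
  have da0 : d / a1 != 0 by rewrite mulf_neq0 // invr_eq0.
  have H := scales_area_comp (scales_area_shear (a2 / a1) (v2 - a2 / a1 * v1) da0)
    (scales_area_comp scales_area_swap
      (scales_area_comp (scales_area_shear b1 v1 a0) scales_area_swap)).
  rewrite !mulr1 !mul1r -normrM (mulrC a1) divfK // in H.
  move: H; congr scales_area; apply/funext => -[x y].
  by rewrite affine2E /unstable.swap /=; congr pair; [ring|rewrite /d; field].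
move=> [a1 a2] [b1 b2]; rewrite /det2 /=.
have [->|a0] := eqVneq a1 0; last exact: key.
rewrite mul0r sub0r oppr_eq0 => d0.
have b0 : b1 != 0 by move: d0; rewrite mulf_eq0 negb_or => /andP[].
have d0' : b1 * a2 - b2 * 0 != 0 by rewrite mulr0 subr0 mulrC.
have := scales_area_comp (key _ _ _ _ b0 d0') scales_area_swap.
rewrite mul1r mulr0 subr0 mulrC -normrN; congr scales_area.
by apply/funext => -[x y]; rewrite /affine2 /unstable.swap /= (addrC (y *: _)).
Qed.

End AffineArea.

(** * Measurability in the plane *)

Section PlaneTopology.
Context {R : realType}.
Local Notation plane := (measurableTypeR R * measurableTypeR R)%type.

(** The product sigma-algebra is generated by rectangles, so an open set is
    written as the union of those squares with rational centre and radius
    1 / (n + 1) that it contains. *)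
Lemma open_measurable_plane (U : set (R * R)) :
  open U -> measurable (U : set plane).
Proof.
move=> oU.
pose B (i : rat * rat * nat) : set (R * R) :=
  ball (ratr i.1.1 : R) i.2.+1%:R^-1 `*` ball (ratr i.1.2 : R) i.2.+1%:R^-1.
have -> : U = \bigcup_i (if `[< B i `<=` U >] then B i else set0).
  apply/seteqP; split => [x Ux|x [i _]]; last first.
    by case: asboolP => // BU /BU.
  have /nbhs_ballP[e /= e0 xeU] : nbhs x U by exact: open_nbhs_nbhs.
  have [n ne] : exists n : nat, n.+1%:R^-1 < e / 2.
    have e20 : 0 < e / 2 by rewrite divr_gt0.
    have := near_infty_natSinv_lt (PosNum e20) => -[N _ /(_ N)] /= h.
    by exists N; apply: h => /=.
  have n0 : 0 < n.+1%:R^-1 :> R by rewrite invr_gt0.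
  have dq (y : R) : exists q : rat, ball (ratr q : R) n.+1%:R^-1 y.
    have [] := @dense_rat R (ball y n.+1%:R^-1).
    - by exists y; exact: ballxx.
    - exact: ball_open.
    - by move=> z [yz [q _ qz]]; exists q; rewrite qz; apply: ball_sym.
  have [[q1 h1] [q2 h2]] := (dq x.1, dq x.2).
  exists (q1, q2, n) => //; case: asboolP => // -[] y [/= y1 y2]; apply: xeU.
  have tri2 (q z w : R) : ball q n.+1%:R^-1 z -> ball q n.+1%:R^-1 w -> ball z e w.
    rewrite /ball /= => qz qw.
    have -> : z - w = (q - w) - (q - z) by ring.
    rewrite (le_lt_trans (ler_normB _ _)) // (splitr e) ltrD //;
      exact: lt_trans ne.
  by split => /=; apply: tri2; [exact: h1|exact: y1|exact: h2|exact: y2].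
apply: countable_bigcupT_measurable => [|i]; first exact: countableP.
case: ifP => // _.
by apply: measurableX; apply: measurable_ball.
Qed.

Lemma continuous_measurable_plane (f : R * R -> R) :
  continuous f -> measurable_fun [set: plane] (f : plane -> R).
Proof.
move=> cf; apply: (measurability _ (RGenOpens.measurableE R)) => _ [_ [a [b ->] <-]].
rewrite setTI; apply: open_measurable_plane.
by apply: open_comp => // x _; exact: cf.
Qed.

Lemma compact_measurable_plane (K : set (R * R)) :
  compact K -> measurable (K : set plane).
Proof.
move=> cK; rewrite -[K]setCK; apply: measurableC; apply: open_measurable_plane.
apply: closed_openC; apply: compact_closed => //; exact: norm_hausdorff.
Qed.

Lemma bounded_area (K : set (R * R)) : bounded_set K -> measurable (K : set plane) ->
  (area K < +oo)%E.
Proof.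
move=> [N [_ bK]] mK.
pose r := N + 1.
have Kr : K `<=` `[- r, r]%classic `*` `[- r, r]%classic.
  move=> x Kx; have /= := bK r _ x Kx; rewrite ltrDl => /(_ ltr01) h.
  rewrite prod_normE in h.
  by split; rewrite /= in_itv /= -ler_norml; move: h; rewrite ge_max => /andP[].
apply: (@le_lt_trans _ _ (area (`[- r, r]%classic `*` `[- r, r]%classic))).
  by apply: le_measure => //; rewrite inE //; exact: measurableX.
rewrite [area _]product_measure1E //= !lebesgue_measure_itv /=.
by case: ifP => _; rewrite ?mule0 ?ltry // -EFinD -EFinM ltry.
Qed.

Lemma continuous_integrable_plane (f : R * R -> R) (K : set (R * R)) :
  continuous f -> compact K -> area.-integrable K (EFin \o f).
Proof.
move=> cf cK; apply: measurable_bounded_integrable.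
- exact: compact_measurable_plane.
- by apply: bounded_area; [exact: compact_bounded|exact: compact_measurable_plane].
- by apply: measurable_funTS; exact: continuous_measurable_plane.
- have : compact (f @` K).
    by apply: continuous_compact => //; exact: continuous_subspaceT.
  move=> /compact_bounded [N [Nr h]]; exists N; split=> // x Nx y Ky.
  by apply: h => //; exists y.
Qed.

End PlaneTopology.

(** * Integrals over triangles *)

Section TriangleIntegral.
Context {R : realType}.
Local Notation leb := (@lebesgue_measure R).
Local Notation plane := (measurableTypeR R * measurableTypeR R)%type.
Implicit Types (v a b : R * R).

Lemma continuous_affine2 v a b : continuous (affine2 v a b).
Proof.
move=> x; apply: cvgD; first exact: cvg_cst.
by apply: cvgD; apply: cvgZ; [exact: cvg_fst|exact: cvg_cst|exact: cvg_snd|exact: cvg_cst].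
Qed.

Lemma affine2_inj v a b : det2 a b != 0 -> injective (affine2 v a b).
Proof.
rewrite /det2 => d0 x y; rewrite !affine2E => -[] h1 h2.
have {h1} h1 : (x.1 - y.1) * a.1 = (y.2 - x.2) * b.1 by move: h1; lra.
have {h2} h2 : (x.1 - y.1) * a.2 = (y.2 - x.2) * b.2 by move: h2; lra.
have e1 : (x.1 - y.1) * (a.1 * b.2 - a.2 * b.1) = 0.
  have -> : (x.1 - y.1) * (a.1 * b.2 - a.2 * b.1) =
    ((x.1 - y.1) * a.1) * b.2 - ((x.1 - y.1) * a.2) * b.1 by ring.
  rewrite h1 h2; ring.
have e2 : (y.2 - x.2) * (a.1 * b.2 - a.2 * b.1) = 0.
  have -> : (y.2 - x.2) * (a.1 * b.2 - a.2 * b.1) =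
    a.1 * ((y.2 - x.2) * b.2) - a.2 * ((y.2 - x.2) * b.1) by ring.
  rewrite -h1 -h2; ring.
move: e1 e2 => /eqP; rewrite mulf_eq0 (negPf d0) orbF subr_eq0 => /eqP e1.
move=> /eqP; rewrite mulf_eq0 (negPf d0) orbF subr_eq0 => /eqP e2.
by apply: injective_projections.
Qed.

Lemma ge0_integral_affine2 v a b (D : set plane) (h : plane -> \bar R) :
  det2 a b != 0 -> measurable D -> measurable_fun setT h -> (forall x, 0 <= h x)%E ->
  (\int[area]_(x in D) h x =
   `|det2 a b|%:E * \int[area]_(x in affine2 v a b @^-1` D) h (affine2 v a b x))%E.
Proof.
move=> d0 mD mh h0.
have [mphi hphi] := scales_area_affine2 v d0.
pose push := measure_function_pushforward__canonical__measure_function_Measure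
  (@area R) mphi.
have -> : (\int[area]_(x in D) h x =
    \int[mscale (NngNum (normr_ge0 (det2 a b))) push]_(x in D) h x)%E.
  by apply: eq_measure_integral => A mA _; rewrite -[LHS](hphi _ mA).
have mhD : measurable_fun D h by exact: measurable_funTS.
have h0D x : D x -> (0 <= h x)%E by move=> _; exact: h0.
rewrite (ge0_integral_mscale push mD (NngNum (normr_ge0 (det2 a b))) mhD h0D).
have h0D' : {in D, forall y, 0 <= h y}%E by move=> x _; exact: h0.
have := ge0_integral_pushforward mphi (@area R) mD mhD h0D'.
by move=> /(congr1 (mule `|det2 a b|%:E)).
Qed.

(** The positive and the negative part of f are transformed separately. *)
Lemma integral_affine2 v a b (f : R * R -> R) (K : set (R * R)) :
  det2 a b != 0 -> continuous f -> compact K ->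
  \int[area]_(x in affine2 v a b @` K) f x =
  `|det2 a b| * \int[area]_(x in K) f (affine2 v a b x).
Proof.
move=> d0 cf cK.
have cphi := @continuous_affine2 v a b.
have cfp : continuous (f \o affine2 v a b).
  by move=> x; apply: continuous_comp; [exact: cphi|exact: cf].
have cK' : compact (affine2 v a b @` K).
  by apply: continuous_compact => //; exact: continuous_subspaceT.
have mK' := compact_measurable_plane cK'.
have KK : affine2 v a b @^-1` (affine2 v a b @` K) = K.
  apply/seteqP; split=> [x [y Ky /(affine2_inj d0) <-//]|x Kx]; by exists x.
have mf := continuous_measurable_plane cf.
have mEf : measurable_fun setT (EFin \o f : plane -> \bar R) by exact/measurable_EFinP.
rewrite /Rintegral integralE.
rewrite (ge0_integral_affine2 v d0 mK') //; last exact: measurable_funepos.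
rewrite (ge0_integral_affine2 v d0 mK' (h := (EFin \o f)^\-%E)) //; last exact: measurable_funeneg.
rewrite KK [in RHS]integralE.
have ig := continuous_integrable_plane cfp cK.
have := integrable_neg_fin_num (compact_measurable_plane cK) ig.
have := integrable_pos_fin_num (compact_measurable_plane cK) ig.
have -> : EFin \o (f \o affine2 v a b) = (EFin \o f) \o affine2 v a b by [].
rewrite (funepos_comp (EFin \o f)) (funeneg_comp (EFin \o f)) /=.
set p := (X in X \is a fin_num -> _); set n := (X in _ -> X \is a fin_num -> _).
move=> hp hn; rewrite -muleBr ?fin_num_adde_defr // fineM //.
by rewrite fin_numB hp.
Qed.

Definition ref_tri : set (R * R) := [set x | [/\ 0 <= x.1, 0 <= x.2 & x.1 + x.2 <= 1]].

Lemma ref_tri_compact : compact ref_tri.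
Proof.
apply: (@subclosed_compact _ _
  ((`[0, 1]%classic : set R) `*` (`[0, 1]%classic : set R))); last 2 first.
- by apply: compact_setX; exact: segment_compact.
- by move=> [x y] [/= *]; rewrite !in_itv /=; split; apply/andP; split; lra.
have -> : ref_tri = (fst @^-1` [set x | 0 <= x]) `&` (snd @^-1` [set x | 0 <= x]) `&`
   ((fun x => x.1 + x.2) @^-1` [set x | x <= 1]).
  by apply/seteqP; split => [x []//|x [[]]].
apply: closedI; [apply: closedI|]; apply: closed_comp => //.
- by move=> x _; exact: cvg_fst.
- by move=> x _; exact: cvg_snd.
- by move=> x _; apply: cvgD; [exact: cvg_fst|exact: cvg_snd].
Qed.

(** Fubini, applied to g extended by zero. *)
Lemma integral_ref_tri (g : R * R -> R) : continuous g ->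
  \int[area]_(x in ref_tri) g x =
  \int[leb]_(s in `[0, 1]) \int[leb]_(t in `[0, 1 - s]) g (s, t).
Proof.
move=> cg.
have mr := compact_measurable_plane ref_tri_compact.
have ig := continuous_integrable_plane cg ref_tri_compact.
rewrite /Rintegral integral_mkcond.
rewrite -[X in fine X]integral12_prod_meas1; last by apply/(integrable_mkcond _ mr).
congr fine; rewrite [RHS]integral_mkcond; apply: eq_integral => x _.
rewrite /fubini_F /patch mem_setE.
have cgx : continuous (fun t => g (x, t)).
  have -> : (fun t => g (x, t)) = g \o (fun t => (x, 0) + t *: (0, 1)).
    apply/funext => t /=; congr g.
    rewrite -[RHS]/(x + t * 0, 0 + t * 1); congr pair; ring.
  move=> t; apply: continuous_comp; last exact: cg.
  by apply: cvgD; [exact: cvg_cst|apply: cvgZ; [exact: cvg_id|exact: cvg_cst]].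
case: ifPn; rewrite in_itv /= => hx.
  rewrite fineK; last first.
    apply: integrable_fin_num => //.
    apply: continuous_compact_integrable; first exact: segment_compact.
    exact: continuous_subspaceT.
  rewrite [RHS]integral_mkcond; apply: eq_integral => t _; rewrite /patch.
  rewrite mem_setE in_itv /=; congr (if _ then _ else _).
  apply/idP/idP; rewrite inE /ref_tri /=.
    by move=> [h1 h2 h3]; apply/andP; split; lra.
  by move=> /andP[h1 h2]; split; lra.
rewrite integral0_eq // => t _; rewrite ifF //; apply/negP; rewrite inE /=.
by move=> [/= h1 h2 h3]; move: hx; rewrite h1 /= -ltNge /= => h; lra.
Qed.

End TriangleIntegral.

(** * Integrals of directional derivatives *)

Section DirectionalGreen.
Context {R : realType}.
Local Notation leb := (@lebesgue_measure R).
Implicit Types (v a b w x : R * R) (F : R * R -> R).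

Definition C1 F := (forall x, differentiable F x) /\ forall w, continuous ('D_w F).

Lemma C1_continuous F : C1 F -> continuous F.
Proof. by move=> [dF _] x; apply: differentiable_continuous; exact: dF. Qed.

Definition mean v w F : R := \int[leb]_(t in `[0, 1]) F (v + t *: (w - v)).

Lemma lineintE v w F : lineint v w F = enorm (w - v) * mean v w F.
Proof. by []. Qed.

Lemma continuous_line F v w : continuous F -> continuous (fun t : R => F (v + t *: w)).
Proof.
rewrite -[X in _ -> continuous X]/(F \o (fun t => v + t *: w)) => cF t.
apply: continuous_comp; last exact: cF.
by apply: cvgD; [exact: cvg_cst|apply: cvgZ; [exact: cvg_id|exact: cvg_cst]].
Qed.

Lemma continuous_itv_integrable (g : R -> R) (c d : R) : continuous g ->
  leb.-integrable `[c, d] (EFin \o g).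
Proof.
move=> cg; apply: continuous_compact_integrable; first exact: segment_compact.
exact: continuous_subspaceT.
Qed.

Lemma derive_line F v w (t : R) : differentiable F (v + t *: w) ->
  derivable (fun t : R => F (v + t *: w)) t 1 /\
  ((fun t : R => F (v + t *: w))^`())%classic t = 'D_w F (v + t *: w).
Proof.
move=> dF; have := @diff_derivable _ _ _ F (v + t *: w) w dF.
rewrite derive1E /derivable /derive.
have -> : (fun h : R => h^-1 *: (F (v + (h *: 1 + t) *: w) - F (v + t *: w))) =
          (fun h : R => h^-1 *: (F (h *: w + (v + t *: w)) - F (v + t *: w))).
  apply/funext => h; congr (_ *: (F _ - _)).
  by rewrite [h *: 1]mulr1 scalerDl addrCA.
by [].
Qed.

Lemma integral_derive_line F v w (d : R) : C1 F -> 0 <= d ->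
  \int[leb]_(t in `[0, d]) 'D_w F (v + t *: w) = F (v + d *: w) - F v.
Proof.
move=> [dF cF]; rewrite le_eqVlt => /predU1P[<-|d0].
  by rewrite set_itv1 Rintegral_set1 scale0r addr0 subrr.
have cg := @continuous_line _ v w (cF w).
have cG := @continuous_line _ v w (C1_continuous (conj dF cF)).
rewrite /Rintegral (continuous_FTC2 (F := fun t => F (v + t *: w)) d0).
- by rewrite scale0r addr0.
- exact: continuous_subspaceT.
- split.
  + by move=> t _; apply (derive_line (dF _)).
  + exact/cvg_at_right_filter/cG.
  + exact/cvg_at_left_filter/cG.
- by move=> t _; apply (derive_line (dF _)).
Qed.

(** Substitution of 1 - t for t. *)
Lemma mean_sym v w F : continuous F -> mean v w F = mean w v F.
Proof.
move=> cF; rewrite /mean /Rintegral; congr fine.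
have cg := @continuous_line F v (w - v) cF.
have mphi := measurable_affine1 (-1 : R) 1.
pose push := measure_function_pushforward__canonical__measure_function_Measure leb mphi.
have pI : (fun y : R => -1 * y + 1) @^-1` `[0, 1]%classic = `[0, 1]%classic.
  by apply/seteqP; split => y /=; rewrite !in_itv /= => /andP[h1 h2];
    apply/andP; split; lra.
transitivity (\int[push]_(t in `[0%R, 1%R]) (F (v + t *: (w - v)))%:E)%E.
  apply: eq_measure_integral => A mA _.
  have N0 : -1 != 0 :> R by rewrite oppr_eq0 oner_eq0.
  by rewrite -[LHS](lebesgue_affine 1 N0 mA) normrN1 mul1e.
have mg : measurable_fun [set: R] (fun t => (F (v + t *: (w - v)))%:E).
  by apply/measurable_EFinP; exact: continuous_measurable_fun.
have cg' : continuous (fun t : R => F (v + (-1 * t + 1) *: (w - v))).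
  rewrite -[X in continuous X]/((fun t : R => F (v + t *: (w - v))) \o (fun t : R => -1 * t + 1)).
  move=> t; apply: continuous_comp; last exact: cg.
  by apply: cvgD; [apply: cvgM; [exact: cvg_cst|exact: cvg_id]|exact: cvg_cst].
have ig : leb.-integrable ((fun y : R => -1 * y + 1) @^-1` `[0, 1]%classic)
    ((fun t => (F (v + t *: (w - v)))%:E) \o (fun y : R => -1 * y + 1)).
  by rewrite pI; exact: (continuous_itv_integrable 0 1 cg').
rewrite [LHS](integral_pushforward mphi mg ig) // pI; apply: eq_integral => t _ /=; congr (F _)%:E.
rewrite scalerDl scale1r mulN1r scaleNr -scalerN opprB addrCA subrKC addrC.
by [].
Qed.

(** In the coordinates v + s a + t b the derivative along b is the one in t, so
    the inner integral is known and leaves the averages of F over the two sides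
    that are not parallel to b. *)
Lemma integral_tri_derive F v a b : det2 a b != 0 -> C1 F ->
  \int[area]_(x in affine2 v a b @` ref_tri) 'D_b F x =
  `|det2 a b| * (mean (v + b) (v + a) F - mean v (v + a) F).
Proof.
move=> d0 C1F; have cF := C1_continuous C1F.
have cD : continuous ('D_b F) by case: C1F.
rewrite (integral_affine2 v d0 cD); last exact: ref_tri_compact.
rewrite integral_ref_tri; last first.
  rewrite -[X in continuous X]/('D_b F \o affine2 v a b) => x.
  by apply: continuous_comp; [exact: continuous_affine2|exact: cD].
congr (_ * _); rewrite /mean -RintegralB //; last 2 first.
- by apply: continuous_itv_integrable; exact: continuous_line.
- by apply: continuous_itv_integrable; exact: continuous_line.
apply: eq_Rintegral => s; rewrite inE /= in_itv /= => /andP[s0 s1].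
have -> : v + b + s *: (v + a - (v + b)) = v + s *: a + (1 - s) *: b.
  by apply: injective_projections; rewrite !planeE; ring.
have -> : v + s *: (v + a - v) = v + s *: a by rewrite addrAC subrr add0r.
have s1' : 0 <= 1 - s by rewrite subr_ge0.
have <- := integral_derive_line (v + s *: a) b C1F s1'.
by apply: eq_Rintegral => t _; rewrite /affine2 /= addrA.
Qed.

Lemma integral_tri_derive2 F v a b : det2 a b != 0 -> C1 F ->
  \int[area]_(x in affine2 v a b @` ref_tri) 'D_a F x =
  `|det2 a b| * (mean (v + b) (v + a) F - mean v (v + b) F).
Proof.
move=> d0 C1F.
have dN : det2 b a = - det2 a b by rewrite /det2; ring.
have -> : affine2 v a b @` ref_tri = affine2 v b a @` ref_tri.
  apply/seteqP; split => _ [x [x1 x2 x12] <-]; exists (x.2, x.1);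
    rewrite /affine2 /= ?(addrC (_ *: b)) ?(addrC (x.2 *: a)) //; split => //=; lra.
rewrite integral_tri_derive ?dN ?oppr_eq0 // normrN.
by rewrite (mean_sym (v + a) (v + b)) //; exact: C1_continuous.
Qed.

End DirectionalGreen.

(** * The divergence theorem on a triangle *)

Section MeshTriangle.
Context {R : realType} (M : mesh R).
Local Notation cell := 'I_(ntri M).
Implicit Types (T : cell) (x v w : R * R) (F G : R * R -> R).

Lemma ord3_ind (P : 'I_3 -> Prop) : P 0 -> P 1 -> P 2%:R -> forall i, P i.
Proof.
move=> P0 P1 P2 [[|[|[|//]]] i].
- by rewrite (_ : Ordinal i = 0) //; apply/val_inj.
- by rewrite (_ : Ordinal i = 1) //; apply/val_inj.
- by rewrite (_ : Ordinal i = 2%:R) //; apply/val_inj.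
Qed.

Lemma sum3 (V : nmodType) (h : 'I_3 -> V) : \sum_i h i = h 0 + h 1 + h 2%:R.
Proof.
rewrite !big_ord_recl big_ord0 addr0 addrA.
by congr (h _ + h _ + h _); apply/val_inj.
Qed.

Lemma add3 : (0 + 1 = 1 :> 'I_3) * (0 + 2%:R = 2%:R :> 'I_3) *
  (1 + 1 = 2%:R :> 'I_3) * (1 + 2%:R = 0 :> 'I_3) *
  (2%:R + 1 = 0 :> 'I_3) * (2%:R + 2%:R = 1 :> 'I_3).
Proof. by do !split; apply/val_inj. Qed.

(** Twice the signed area of T. *)
Definition tdet T : R := det2 (vtx T 1 - vtx T 0) (vtx T 2%:R - vtx T 0).

Lemma triE T : tri T =
  affine2 (vtx T 0) (vtx T 1 - vtx T 0) (vtx T 2%:R - vtx T 0) @` ref_tri.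
Proof.
apply/seteqP; split => x.
  move=> [l [l0 ]]; rewrite !sum3 => l1 ->.
  exists (l 1, l 2%:R).
    by split => /=; rewrite ?l0 //; have := l0 0; move: l1; lra.
  have -> : l 0 = 1 - l 1 - l 2%:R by rewrite -l1; ring.
  by apply: injective_projections; rewrite /affine2 !planeE /=; ring.
move=> [y [y1 y2 y12] <-].
exists (fun i => if i == 0 then 1 - y.1 - y.2 else if i == 1 then y.1 else y.2).
split.
- by apply: ord3_ind => /=; lra.
- by rewrite sum3 /=; ring.
- rewrite sum3 /=.
  by apply: injective_projections; rewrite /affine2 !planeE /=; ring.
Qed.

Lemma tri_compact T : compact (tri T).
Proof.
rewrite triE; apply: continuous_compact; last exact: ref_tri_compact.
by apply: continuous_subspaceT; exact: continuous_affine2.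
Qed.

Lemma integrable_tri T F : continuous F -> area.-integrable (tri T) (EFin \o F).
Proof. by move=> cF; apply: continuous_integrable_plane => //; exact: tri_compact. Qed.

Lemma intTD T F G : continuous F -> continuous G ->
  intT T (fun x => F x + G x) = intT T F + intT T G.
Proof.
move=> cF cG; apply: RintegralD; [|exact: integrable_tri..].
by apply: compact_measurable_plane; exact: tri_compact.
Qed.

Lemma intTZ T F (c : R) : continuous F -> intT T (fun x => c * F x) = c * intT T F.
Proof.
move=> cF; apply: RintegralZl; [|exact: integrable_tri].
by apply: compact_measurable_plane; exact: tri_compact.
Qed.

Lemma meanD v w F G : continuous F -> continuous G ->
  mean v w (fun x => F x + G x) = mean v w F + mean v w G.
Proof.
by move=> cF cG; apply: RintegralD => //; apply: continuous_itv_integrable;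
  exact: continuous_line.
Qed.

Lemma meanZ v w F (c : R) : continuous F -> mean v w (fun x => c * F x) = c * mean v w F.
Proof.
by move=> cF; apply: RintegralZl => //; apply: continuous_itv_integrable;
  exact: continuous_line.
Qed.

Lemma det2C (x y : R * R) : det2 x y = - det2 y x.
Proof. by rewrite /det2; ring. Qed.

Lemma side_det (T : cell) (i : 'I_3) :
  det2 (sb (T, i) - sa (T, i)) (sopp (T, i) - sa (T, i)) = tdet T.
Proof.
move: i; apply: ord3_ind; rewrite /sb /sa /sopp /= ?add3 /tdet /det2 !planeE; ring.
Qed.

Lemma dot_eq0 x : (dot x x == 0) = (x == 0).
Proof.
apply/eqP/eqP => [|->]; last by rewrite /dot /= mulr0 addr0.
move=> /eqP; rewrite /dot -!expr2 paddr_eq0 ?sqr_ge0 // !sqrf_eq0.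
by move=> /andP[/eqP h1 /eqP h2]; apply: injective_projections.
Qed.

Lemma enorm_eq0 x : (enorm x == 0) = (x == 0).
Proof.
rewrite /enorm sqrtr_eq0 -dot_eq0 eq_le; apply/idP/idP => [->/=|/andP[]//].
by rewrite /dot -!expr2 addr_ge0 ?sqr_ge0.
Qed.

Lemma side_neq0 (T : cell) (i : 'I_3) : tdet T != 0 -> sb (T, i) - sa (T, i) != 0.
Proof.
apply: contra => /eqP h; rewrite -(side_det T i) h /det2 /=.
by rewrite !mul0r subrr.
Qed.

(** The sign of the area tells whether the side vector, rotated by a right
    angle, points out of the triangle. *)
Lemma onormalE (T : cell) (i : 'I_3) : tdet T != 0 ->
  let t := sb (T, i) - sa (T, i) in
  onormal (T, i) = (Num.sg (tdet T) / enorm t) *: (t.2, - t.1).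
Proof.
move=> d0 t; rewrite /onormal -/t.
have -> : dot ((enorm t)^-1 *: (t.2, - t.1)) (sopp (T, i) - sa (T, i)) =
   - ((enorm t)^-1 * tdet T).
  by rewrite -(side_det T i) -/t /dot /det2 !planeE /=; ring.
rewrite sgrN opprK sgrM sgrV gtr0_sg ?mul1r ?scalerA //.
by rewrite lt_neqAle eq_sym enorm_eq0 side_neq0 //= sqrtr_ge0.
Qed.

Lemma derive_comb F x (w a b : R * R) (c d : R) : differentiable F x ->
  w = c *: a + d *: b -> 'D_w F x = c * 'D_a F x + d * 'D_b F x.
Proof.
by move=> dF ->; rewrite !deriveE // linearD !linearZ.
Qed.

(** Partial derivatives in terms of derivatives along two sides, by the rule of
    Cramer. *)
Lemma derive_e1 F x (a b : R * R) : det2 a b != 0 -> differentiable F x ->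
  'D_(1, 0) F x = (b.2 / det2 a b) * 'D_a F x + (- a.2 / det2 a b) * 'D_b F x.
Proof.
move=> ab0 dF; apply: derive_comb => //.
by apply: injective_projections; rewrite !planeE; move: ab0; rewrite /det2 => ab0;
  [rewrite -[LHS]/(1 : R)|rewrite -[LHS]/(0 : R)]; field.
Qed.

Lemma derive_e2 F x (a b : R * R) : det2 a b != 0 -> differentiable F x ->
  'D_(0, 1) F x = (- b.1 / det2 a b) * 'D_a F x + (a.1 / det2 a b) * 'D_b F x.
Proof.
move=> ab0 dF; apply: derive_comb => //.
by apply: injective_projections; rewrite !planeE; move: ab0; rewrite /det2 => ab0;
  [rewrite -[LHS]/(0 : R)|rewrite -[LHS]/(1 : R)]; field.
Qed.

Lemma continuous_cst (c : R) : continuous (fun _ : R * R => c).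
Proof. by move=> x; exact: cvg_cst. Qed.

(** The divergence theorem. Partial derivatives are expressed through the
    derivatives along two sides, whose integrals are differences of averages over
    sides; collecting these by sides, the side with vector t receives the rotated
    vector t as coefficient, which is its outer normal times its length. *)
Lemma Green_tri T F G : tdet T != 0 -> C1 F -> C1 G ->
  intT T (fun x => 'D_(1, 0) F x + 'D_(0, 1) G x) =
  \sum_i lineint (sa (T, i)) (sb (T, i)) (fun x => dot (F x, G x) (onormal (T, i))).
Proof.
move=> d0 hF hG.
have cF := C1_continuous hF; have cG := C1_continuous hG.
have line i : lineint (sa (T, i)) (sb (T, i)) (fun x => dot (F x, G x) (onormal (T, i)))
  = Num.sg (tdet T) *
    (mean (sa (T, i)) (sb (T, i)) F * (sb (T, i) - sa (T, i)).2
     - mean (sa (T, i)) (sb (T, i)) G * (sb (T, i) - sa (T, i)).1).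
  have t0 := side_neq0 i d0.
  rewrite onormalE // lineintE; set t := _ - _ in t0 *.
  have -> : (fun x => dot (F x, G x) ((Num.sg (tdet T) / enorm t) *: (t.2, - t.1)))
    = (fun x => (Num.sg (tdet T) / enorm t * t.2) * F x
         + (- (Num.sg (tdet T) / enorm t * t.1)) * G x).
    by apply/funext => x; rewrite /dot !planeE /=; ring.
  rewrite meanD ?meanZ //; last 2 first.
  - by move=> x; apply: cvgM; [exact: cvg_cst|exact: cF].
  - by move=> x; apply: cvgM; [exact: cvg_cst|exact: cG].
  by rewrite -enorm_eq0 in t0; field.
rewrite sum3 !line /intT triE.
set v := vtx T 0; set a := vtx T 1 - v; set b := vtx T 2%:R - v.
have dab : det2 a b = tdet T by [].
have ab0 : det2 a b != 0 by rewrite dab.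
have va : v + a = vtx T 1 by rewrite /a addrC subrK.
have vb : v + b = vtx T 2%:R by rewrite /b addrC subrK.
pose e := tdet T.
have D1 x : 'D_(1, 0) F x = (b.2 / e) * 'D_a F x + (- a.2 / e) * 'D_b F x.
  by rewrite (derive_e1 ab0) //; case: hF.
have D2 x : 'D_(0, 1) G x = (- b.1 / e) * 'D_a G x + (a.1 / e) * 'D_b G x.
  by rewrite (derive_e2 ab0) //; case: hG.
under eq_Rintegral do rewrite D1 D2.
have cD c w H : C1 H -> continuous (fun x => c * 'D_w H x).
  by move=> [_ cH] x; apply: cvgM; [exact: cvg_cst|exact: cH].
have cDD c d w w' H : C1 H -> continuous (fun x => c * 'D_w H x + d * 'D_w' H x).
  by move=> hH x; apply: cvgD; exact: cD.
have [[_ cF'] [_ cG']] := (hF, hG).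
rewrite -triE -/(intT _ _) intTD; [|exact: cDD|exact: cDD].
rewrite !intTD; [|exact: cD..].
rewrite (intTZ _ _ (cF' a)) (intTZ _ _ (cF' b)) (intTZ _ _ (cG' a)) (intTZ _ _ (cG' b)).
rewrite /intT triE -/v -/a -/b.
rewrite (integral_tri_derive v ab0 hF) (integral_tri_derive v ab0 hG).
rewrite (integral_tri_derive2 v ab0 hF) (integral_tri_derive2 v ab0 hG).
rewrite /sa /sb /= !add3 va vb (mean_sym (vtx T 2%:R) (vtx T 1)) //
  (mean_sym (vtx T 2%:R) (vtx T 1) cG) (mean_sym (vtx T 2%:R) (vtx T 0) cF)
  (mean_sym (vtx T 2%:R) (vtx T 0) cG) -/v.
rewrite dab -/e (_ : vtx T 1 = v + a) // (_ : vtx T 2%:R = v + b) // !planeE.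
have e0 : e != 0 by [].
by rewrite [`|e|]normrEsg; field.
Qed.

End MeshTriangle.

(** * Continuously differentiable functions *)

Section SmoothFunctions.
Context {R : realType}.
Implicit Types (w x : R * R) (F G : R * R -> R).

Lemma C1_cst (c : R) : C1 (fun _ : R * R => c).
Proof.
split=> [x|w]; first exact: differentiable_cst.
rewrite (_ : 'D_w _ = fun _ => 0); first by move=> x; exact: cvg_cst.
by apply/funext => x; rewrite derive_cst.
Qed.

Lemma C1_ext F G : (forall x, F x = G x) -> C1 F -> C1 G.
Proof. by move=> FG; have -> : G = F by apply/funext. Qed.

Lemma C1_linear (L : {linear (R * R)%type -> R}) : continuous L -> C1 L.
Proof.
move=> cL; split=> [x|w]; first exact: linear_differentiable.
rewrite (_ : 'D_w _ = fun _ => L w); first by move=> x; exact: cvg_cst.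
apply/funext => x; rewrite deriveE; last exact: linear_differentiable.
by rewrite (diff_lin _ cL).
Qed.

Lemma C1_fst : C1 (fst : R * R -> R).
Proof. by apply: C1_linear => x; exact: cvg_fst. Qed.

Lemma C1_snd : C1 (snd : R * R -> R).
Proof. by apply: C1_linear => x; exact: cvg_snd. Qed.

Lemma C1D F G : C1 F -> C1 G -> C1 (fun x => F x + G x).
Proof.
move=> [dF cF] [dG cG]; split=> [x|w]; first exact: differentiableD.
rewrite (_ : 'D_w _ = fun x => 'D_w F x + 'D_w G x).
  by move=> x; apply: cvgD; [exact: cF|exact: cG].
by apply/funext => x; rewrite [LHS]deriveD //; exact: diff_derivable.
Qed.

Lemma deriveMf F G x w : differentiable F x -> differentiable G x ->
  'D_w (fun y => F y * G y) x = F x * 'D_w G x + G x * 'D_w F x.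
Proof. by move=> dF dG; rewrite [LHS]deriveM //; exact: diff_derivable. Qed.

Lemma C1M F G : C1 F -> C1 G -> C1 (fun x => F x * G x).
Proof.
move=> hF hG; have cF0 := C1_continuous hF; have cG0 := C1_continuous hG.
move: hF hG => [dF cF] [dG cG]; split=> [x|w]; first exact: differentiableM.
rewrite (_ : 'D_w _ = fun x => F x * 'D_w G x + G x * 'D_w F x).
  by move=> x; apply: cvgD; apply: cvgM;
    [exact: cF0|exact: cG|exact: cG0|exact: cF].
by apply/funext => x; exact: deriveMf.
Qed.

Lemma C1_sum n (F : 'I_n -> R * R -> R) : (forall i, C1 (F i)) ->
  C1 (fun x => \sum_(i < n) F i x).
Proof.
move=> hF; elim: n F hF => [|n IHn] F hF.
  by apply: C1_ext (C1_cst 0) => x; rewrite big_ord0.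
apply: (@C1_ext (fun x => \sum_(i < n) F (widen_ord (leqnSn n) i) x + F ord_max x)).
  by move=> x; rewrite big_ord_recr.
by apply: C1D => //; exact: (IHn (fun i => F (widen_ord (leqnSn n) i))).
Qed.

Lemma C1X F n : C1 F -> C1 (fun x => F x ^+ n).
Proof.
move=> hF; elim: n => [|n IHn]; first exact: C1_cst.
by apply: C1_ext (C1M hF IHn) => x; rewrite exprS.
Qed.

Lemma Pol_C1 n F : Pol n F -> C1 F.
Proof.
move=> [c hF]; apply: C1_ext (fun x => esym (hF x)) _.
apply: C1_sum => i; apply: C1_sum => j; apply: C1M; last exact: C1X C1_snd.
by apply: C1M; [exact: C1_cst|exact: C1X C1_fst].
Qed.

(** A C^1 function that vanishes exactly on a half-line; compositions with it
    have controlled supports. *)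
Definition sqpos (y : R) : R := Num.max 0 y ^+ 2.

(** A bound on the first order remainder that is uniform in y, so that the kink
    of the positive part at 0 needs no special treatment. *)
Lemma sqpos_quotient (y t : R) :
  `|sqpos (t + y) - sqpos y - 2 * Num.max 0 y * t| <= t ^+ 2.
Proof.
rewrite /sqpos /Num.max ler_norml; case: ltP => h1; case: ltP => h2;
  apply/andP; split; nra.
Qed.

Lemma sqpos_derive (y : R) :
  (fun t => t^-1 *: (sqpos (t *: 1 + y) - sqpos y)) @ 0^' --> 2 * Num.max 0 y.
Proof.
apply/cvgrPdist_le => e e0; near=> t.
have t0 : t != 0 by near: t; exact: nbhs_dnbhs_neq.
have te : `|t| <= e by near: t; apply: dnbhs0_le.
rewrite -normrN opprB; apply: le_trans te.
have -> : t^-1 *: (sqpos (t *: 1 + y) - sqpos y) - 2 * Num.max 0 y =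
    (sqpos (t + y) - sqpos y - 2 * Num.max 0 y * t) / t.
  by rewrite /GRing.scale /= mulr1; field.
rewrite normrM normfV ler_pdivrMr ?normr_gt0 //.
by rewrite -normrM -expr2 [`|t ^+ 2|]ger0_norm ?sqr_ge0 // sqpos_quotient.
Unshelve. all: by end_near.
Qed.

Lemma sqpos_derivable (y : R) : derivable sqpos y 1.
Proof. by apply/cvg_ex; exists (2 * Num.max 0 y); exact: sqpos_derive. Qed.

Lemma C1_sqpos F : C1 F -> C1 (fun x => sqpos (F x)).
Proof.
move=> hF; have cF := C1_continuous hF; move: hF => [dF cD].
have ds y : differentiable sqpos y by apply/derivable1_diffP; exact: sqpos_derivable.
have dc x : differentiable (sqpos \o F) x by exact: differentiable_comp.
have cm : continuous (fun x => Num.max 0 (F x)).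
  have -> : (fun x => Num.max 0 (F x)) = (fun x => (F x + `|F x|) / 2).
    by apply/funext => x; rewrite maxr_absE add0r sub0r normrN.
  move=> x; apply: cvgM; last exact: cvg_cst.
  by apply: cvgD; [exact: cF|apply: cvg_norm; exact: cF].
split=> [x|w]; first exact: dc.
rewrite (_ : 'D_w _ = fun x => 'D_w F x * (2 * Num.max 0 (F x))).
  move=> x; apply: cvgM; first exact: cD.
  apply: cvgM; first exact: cvg_cst.
  exact: cm.
apply/funext => x; rewrite -[LHS]/('D_w (sqpos \o F) x) deriveE // diff_comp //=.
rewrite deriv1E; last exact: sqpos_derivable.
rewrite derive1E /= -deriveE // -[LHS]/(_ * _).
by congr (_ * _); apply: cvg_lim => //; exact: sqpos_derive.
Qed.

End SmoothFunctions.

(** * Test functions that concentrate on a line *)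

Section Spikes.
Context {R : realType}.
Local Notation plane := (measurableTypeR R * measurableTypeR R)%type.
Implicit Types (x l : R * R) (d : R) (n : nat).

Lemma dot_ge0 x : 0 <= dot x x.
Proof. by rewrite /dot -!expr2 addr_ge0 ?sqr_ge0. Qed.

(** An affine change of variables maps the line to a coordinate axis. *)
Lemma line_null x0 l : l != 0 ->
  measurable ([set x | dot l (x - x0) = 0] : set plane) /\
  area [set x | dot l (x - x0) = 0] = 0%E.
Proof.
move=> l0; set L := [set x | _].
have c : continuous (fun x => dot l (x - x0)).
  apply: C1_continuous; rewrite /dot.
  apply: C1D; apply: C1M; try exact: C1_cst.
    by apply: C1_ext (C1D C1_fst (C1_cst (- x0.1))) => x; rewrite !planeE.
  by apply: C1_ext (C1D C1_snd (C1_cst (- x0.2))) => x; rewrite !planeE.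
have mL : measurable (L : set plane).
  rewrite -[X in measurable X]setCK; apply: measurableC; apply: open_measurable_plane.
  apply: closed_openC.
  by apply: (closed_comp (f := fun x => dot l (x - x0)) (D := [set 0])) => [x _|];
    [exact: c|exact: closed_eq].
split=> //.
have d0 : det2 (l.2, - l.1) l != 0.
  rewrite /det2 /= (_ : _ - _ = dot l l); last by rewrite /dot; ring.
  by rewrite dot_eq0.
have [_ hL] := scales_area_affine2 x0 d0.
rewrite -(hL L mL).
have -> : affine2 x0 (l.2, - l.1) l @^-1` L = setT `*` [set 0].
  apply/seteqP; split => x; rewrite /L /= /dot /affine2 !planeE /=.
    have -> : l.1 * (x0.1 + (x.1 * l.2 + x.2 * l.1) - x0.1) +
      l.2 * (x0.2 + (x.1 * - l.1 + x.2 * l.2) - x0.2) = x.2 * dot l l.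
      by rewrite /dot; ring.
    by move=> /eqP; rewrite mulf_eq0 dot_eq0 (negPf l0) orbF => /eqP.
  by move=> [_ ->]; ring.
by rewrite [area _]product_measure1E //= lebesgue_measure_set1 mule0 mule0.
Qed.

(** A bump supported in the disk of radius d about x0, which gets narrower around
    the line through x0 with normal l as n grows, while its values on this line
    do not depend on n. *)
Definition spike x0 l d n x : R :=
  sqpos (d ^+ 2 - dot (x - x0) (x - x0) - n%:R * dot l (x - x0) ^+ 2).

Lemma spike_C1 x0 l d n : C1 (spike x0 l d n).
Proof.
apply: C1_sqpos.
have c1 : C1 (fun x => (x - x0).1).
  by apply: C1_ext (C1D C1_fst (C1_cst (- x0.1))) => x; rewrite !planeE.
have c2 : C1 (fun x => (x - x0).2).
  by apply: C1_ext (C1D C1_snd (C1_cst (- x0.2))) => x; rewrite !planeE.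
have cN F : C1 F -> C1 (fun x => - F x).
  by move=> hF; apply: C1_ext (C1M (C1_cst (-1)) hF) => x; rewrite mulN1r.
apply: C1D; last apply: cN.
  apply: C1D; first exact: C1_cst.
  by apply: cN; apply: C1D; apply: C1M; [exact: c1|exact: c1|exact: c2|exact: c2].
apply: C1M; first exact: C1_cst.
by apply: C1X; apply: C1D; apply: C1M; [exact: C1_cst|exact: c1|exact: C1_cst|exact: c2].
Qed.

Lemma spike_ge0 x0 l d n x : 0 <= spike x0 l d n x.
Proof. by rewrite /spike /sqpos sqr_ge0. Qed.

Lemma spike_out x0 l d n x : d ^+ 2 <= dot (x - x0) (x - x0) + n%:R * dot l (x - x0) ^+ 2 ->
  spike x0 l d n x = 0.
Proof.
move=> h; rewrite /spike /sqpos; have -> : Num.max 0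
  (d ^+ 2 - dot (x - x0) (x - x0) - n%:R * dot l (x - x0) ^+ 2) = 0.
  by apply/max_idPl; move: h; lra.
by rewrite expr0n.
Qed.

Lemma spike_far x0 l d n x : d ^+ 2 <= dot (x - x0) (x - x0) -> spike x0 l d n x = 0.
Proof.
by move=> h; apply: spike_out; rewrite (le_trans h) // lerDl mulr_ge0 ?sqr_ge0.
Qed.

Lemma spike_line x0 l d n x : dot l (x - x0) = 0 -> spike x0 l d n x = spike x0 l d 0 x.
Proof. by rewrite /spike => ->; rewrite expr0n /= !mulr0. Qed.

Lemma spike_le x0 l d n x : spike x0 l d n x <= d ^+ 4.
Proof.
rewrite /spike /sqpos (_ : d ^+ 4 = (d ^+ 2) ^+ 2); last by rewrite -exprM.
rewrite lerXn2r ?nnegrE ?sqr_ge0 ?le_max ?lexx // ge_max sqr_ge0 /=.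
have h1 := dot_ge0 (x - x0).
have h2 : 0 <= n%:R * dot l (x - x0) ^+ 2 by rewrite mulr_ge0 ?sqr_ge0.
by move: h1 h2; lra.
Qed.

Lemma spike_cvg x0 l d x : dot l (x - x0) != 0 ->
  \forall n \near \oo, spike x0 l d n x = 0.
Proof.
move=> hl; have hl2 : 0 < dot l (x - x0) ^+ 2 by rewrite exprn_even_gt0.
have [N hN] : exists N : nat, d ^+ 2 / dot l (x - x0) ^+ 2 <= N%:R.
  exists (Num.bound (d ^+ 2 / dot l (x - x0) ^+ 2)).
  by apply/ltW/archi_boundP; rewrite divr_ge0 ?sqr_ge0.
near=> n; apply: spike_out.
rewrite -[X in X <= _]add0r lerD ?dot_ge0 // -ler_pdivrMr //.
rewrite (le_trans hN) // ler_nat.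
by near: n; exists N.
Unshelve. all: by end_near.
Qed.

(** Off a null line the spikes are eventually zero, and they are bounded by
    d ^+ 4. *)
Lemma integral_spike_cvg x0 l d (D : set (R * R)) (G : R * R -> R) : l != 0 ->
  measurable (D : set plane) -> area.-integrable D (EFin \o G) ->
  (fun n => \int[area]_(x in D) (G x * spike x0 l d n x)) @ \oo --> 0.
Proof.
move=> l0 mD iG.
have mG : measurable_fun D (G : plane -> R).
  by apply/measurable_EFinP; case/integrableP: iG.
have ms n : measurable_fun D (spike x0 l d n : plane -> R).
  apply: measurable_funTS; apply: continuous_measurable_plane.
  exact: C1_continuous (spike_C1 _ _ _ _).
have d4 : 0 <= d ^+ 4 by rewrite (_ : d ^+ 4 = (d ^+ 2) ^+ 2) ?sqr_ge0 // -exprM.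
have mL : (@area R).-negligible [set x | dot l (x - x0) = 0].
  have [mL aL] := line_null x0 l0.
  by exists [set x | dot l (x - x0) = 0]; split.
have := @dominated_convergence _ _ _ (@area R) D mD
  (fun n x => (G x * spike x0 l d n x)%:E) (cst 0%E) (fun x => (d ^+ 4)%:E * `|(G x)%:E|)%E.
case.
- by move=> n; apply/measurable_EFinP; apply: measurable_funM; [exact: mG|exact: ms].
- exact: measurable_cst.
- apply: negligibleS mL => x /= /not_implyP[Dx h].
  apply: contrapT => /eqP hl; apply: h.
  apply: cvg_near_cst; near=> n.
  by rewrite /cst (near (@spike_cvg x0 l d x hl)) // mulr0.
- by apply: integrableZl => //; exact: integrable_abse.
- apply: aeW => x n Dx; rewrite /= normrM mulrC EFinM lee_pmul ?lee_fin //.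
  by rewrite ger0_norm ?spike_ge0 // spike_le.
move=> _ _; rewrite integral0 => h.
exact: (fine_cvg h).
Unshelve. all: by end_near.
Qed.

End Spikes.

(** * Geometry of the mesh *)

Section MeshGeometry.
Context {R : realType} (M : mesh R) (Omega : set (R * R)).
Local Notation cell := 'I_(ntri M).
Hypothesis meshO : triangulates M Omega.
Implicit Types (T : cell) (x y : R * R) (e : side M).

Lemma tdet_neq0 T : tdet T != 0.
Proof. by have [h _ _ _] := meshO; exact: h. Qed.

(** Barycentric coordinates measured from the side (T, i): the distance of x from
    that side, relative to the height of T over it. *)
Lemma baryE T i x :
  bary T i x = det2 (sb (T, i) - sa (T, i)) (x - sa (T, i)) / tdet T.
Proof.
have := tdet_neq0 T; rewrite -(side_det T i) /bary => d0.
rewrite det2C [in X in _ / X](det2C (sopp _ - _)).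
by rewrite invrN mulrNN.
Qed.

Lemma bary_affine T i x y (c : R) :
  bary T i (x + c *: (y - x)) = bary T i x + c * (bary T i y - bary T i x).
Proof. by rewrite !baryE /det2 !planeE; ring. Qed.

Lemma bary_sum T x : \sum_i bary T i x = 1.
Proof.
have := tdet_neq0 T; rewrite sum3 !baryE /sa /sb /= !add3 => d0.
rewrite -!mulrDl; apply: (mulIf d0); rewrite divfK // mul1r /tdet /det2 !planeE; ring.
Qed.

Lemma bary_point T x : x = \sum_i bary T i x *: vtx T i.
Proof.
have := tdet_neq0 T; rewrite sum3 !baryE /sa /sb /= !add3 => d0.
have E a0 a1 a2 c0 c1 c2 : a0 / tdet T * c0 + a1 / tdet T * c1 + a2 / tdet T * c2 =
  (a0 * c0 + a1 * c1 + a2 * c2) / tdet T by ring.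
by apply: injective_projections; rewrite !planeE E; apply: (canRL (mulfK d0));
  rewrite /tdet /det2 !planeE; ring.
Qed.

Lemma bary_ge0_tri T x : (forall i, 0 <= bary T i x) -> tri T x.
Proof.
move=> h; exists (fun i => bary T i x).
by split=> //; [exact: bary_sum|exact: bary_point].
Qed.

Definition side_pt e (t : R) : R * R := sa e + t *: (sb e - sa e).

Lemma bary_side T (i j : 'I_3) (t : R) : bary T j (side_pt (T, i) t) =
  if j == i then 0 else if j == i + 1 then 1 - t else t.
Proof.
rewrite (_ : side_pt _ _ =
  \sum_j (if j == i then 0 else if j == i + 1 then 1 - t else t) *: vtx T j).
  apply: (bary_comb (w := fun j => if j == i then 0 else if j == i + 1 then 1 - t else t)).
    exact: tdet_neq0.
  by rewrite sum3; move: i; apply: ord3_ind; rewrite ?add3 /=; ring.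
rewrite sum3 /side_pt; move: i; apply: ord3_ind; rewrite /sa /sb /= ?add3 /=;
  by apply: injective_projections; rewrite !planeE; ring.
Qed.

Lemma bary_sopp T i : bary T i (sopp (T, i)) = 1.
Proof. by rewrite baryE side_det divff // tdet_neq0. Qed.

(** The relative interior of a side. *)
Definition side_int e x := exists2 t : R, 0 < t < 1 & x = side_pt e t.

Lemma ssegP e x : sseg e x <-> exists2 t : R, 0 <= t <= 1 & x = side_pt e t.
Proof.
split => [[t]|[t t01 ->]]; first by rewrite /= in_itv /= => ? <-; exists t.
by exists t => //=; rewrite in_itv.
Qed.

Lemma side_int_sseg e x : side_int e x -> sseg e x.
Proof. by move=> [t /andP[t0 t1] ->]; apply/ssegP; exists t; rewrite // !ltW. Qed.

Lemma sseg_tri e : sseg e `<=` tri e.1.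
Proof.
case: e => T i x /ssegP [t /andP[t0 t1] ->]; apply: bary_ge0_tri => j.
by rewrite bary_side; case: ifP => // _; case: ifP => // _; rewrite subr_ge0.
Qed.

Lemma side_int_inj T i j x : side_int (T, i) x -> sseg (T, j) x -> i = j.
Proof.
move=> [t /andP[t0 t1] ->] /ssegP [s _] /(congr1 (bary T j)).
rewrite !bary_side eqxx; have [->//|_] := eqVneq j i.
by case: ifP => _ h; exfalso; move: t0 t1; lra.
Qed.

Lemma side_int_not_vtx T i k x : side_int (T, i) x -> x <> vtx T k.
Proof.
move=> [t /andP[t0 t1] ->] /(congr1 (bary T k)).
rewrite bary_side -[vtx T k]/(sopp (T, k)) bary_sopp.
by case: ifP => _; [|case: ifP => _]; move: t0 t1; lra.
Qed.

Lemma sa_neq_sb e : sb e - sa e != 0.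
Proof. by case: e => T i; apply: side_neq0; exact: tdet_neq0. Qed.

Lemma side_pt_inj e : injective (side_pt e).
Proof.
move=> s t /addrI /eqP; rewrite -subr_eq0 -scalerBl scaler_eq0 (negPf (sa_neq_sb e)).
by rewrite orbF subr_eq0 => /eqP.
Qed.

Lemma same_endsP e e' : same_ends e e' ->
  (forall t, side_pt e' t = side_pt e t) \/ (forall t, side_pt e' t = side_pt e (1 - t)).
Proof.
rewrite /side_pt => /orP[] /andP[/eqP <- /eqP <-]; [by left|right=> t].
by apply: injective_projections; rewrite !planeE; ring.
Qed.

Lemma same_ends_sym e e' : same_ends e e' = same_ends e' e.
Proof.
by rewrite /same_ends !(eq_sym (sa e')) !(eq_sym (sb e')) [(sb e == sa e') && _]andbC.
Qed.

Lemma same_ends_trans e e' e'' : same_ends e e' -> same_ends e' e'' -> same_ends e e''.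
Proof.
by rewrite /same_ends => /orP[] /andP[/eqP -> /eqP ->] // /orP[] /andP[/eqP -> /eqP ->];
  rewrite !eqxx ?orbT.
Qed.

Lemma same_ends_sseg e e' : same_ends e e' -> sseg e = sseg e'.
Proof.
move=> h; suff H e1 e2 : same_ends e1 e2 -> sseg e1 `<=` sseg e2.
  by apply/seteqP; split; apply: H => //; rewrite same_ends_sym.
rewrite same_ends_sym => /same_endsP[] E x /ssegP[t t01 ->]; apply/ssegP.
  by exists t.
by exists (1 - t); [move: t01 => /andP[? ?]; apply/andP; split; lra|].
Qed.

Lemma same_ends_side_int e e' x : same_ends e e' -> side_int e x -> side_int e' x.
Proof.
rewrite same_ends_sym => /same_endsP[] E [t t01 ->].
  by exists t.
by exists (1 - t); [move: t01 => /andP[? ?]; apply/andP; split; lra|].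
Qed.

(** The ends of a segment are its extreme points: if the ends of e' have the
    parameters s and t in e, then the ends 0 and 1 of e are convex combinations of
    s and t. *)
Lemma sseg_same_ends e e' : sseg e = sseg e' -> same_ends e e'.
Proof.
move=> E.
have in0 e1 : sseg e1 (side_pt e1 0) by apply/ssegP; exists 0; rewrite ?lexx ?ler01.
have in1 e1 : sseg e1 (side_pt e1 1) by apply/ssegP; exists 1; rewrite ?lexx ?ler01.
have p0 e1 : side_pt e1 0 = sa e1 by rewrite /side_pt scale0r addr0.
have p1 e1 : side_pt e1 1 = sb e1 by rewrite /side_pt scale1r addrC subrK.
have : sseg e (sa e') by rewrite E -p0.
have : sseg e (sb e') by rewrite E -p1.
have : sseg e' (sa e) by rewrite -E -p0.
have : sseg e' (sb e) by rewrite -E -p1.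
move=> /ssegP[q /andP[q0 q1] hq] /ssegP[p /andP[p0' p1'] hp].
move=> /ssegP[t /andP[t0 t1] ht] /ssegP[s /andP[s0 s1] hs].
have comp z : side_pt e' z = side_pt e (s + z * (t - s)).
  rewrite {1}/side_pt hs ht /side_pt.
  by apply: injective_projections; rewrite !planeE; ring.
move: hp hq; rewrite !comp -{1}p0 -{1}p1 => /side_pt_inj hp /side_pt_inj hq.
have a1 : (1 - p) * s = 0 by have := mulr_ge0 p0' t0; nra.
have a2 : p * t = 0 by move: hp a1; lra.
rewrite /same_ends.
move: a2 => /eqP; rewrite mulf_eq0 => /orP[] /eqP z0.
  have s0' : s = 0 by move: a1; rewrite z0; lra.
  have qt : q * t = 1 by move: hq; rewrite s0'; lra.
  have t1' : t = 1 by nra.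
  by rewrite hs ht s0' t1' p0 p1 !eqxx.
have s1' : s = 1 by move: hq; rewrite z0; nra.
by rewrite hs ht s1' z0 p0 p1 !eqxx orbT.
Qed.

(** A relative interior point of a side is no vertex and lies on no other side of
    the same triangle, so the absence of hanging nodes leaves only a common
    side. *)
Lemma side_int_shared e e' x : side_int e x -> sseg e' x -> same_ends e e'.
Proof.
case: e e' => T i [T' j] hr hs.
have [TT'|TT'] := eqVneq T T'.
  by move: hs; rewrite -TT' => /(side_int_inj hr) ->; rewrite /same_ends !eqxx.
have xT : tri T x by apply: (sseg_tri (e := (T, i))); exact: side_int_sseg.
have xT' : tri T' x by exact: (sseg_tri (e := (T', j))).
have [_ _ _ /(_ T T' TT')] := meshO; case.
- by move=> TT0; suff : (tri T `&` tri T') x by rewrite TT0.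
- move=> [k [k' [_ E]]]; have : (tri T `&` tri T') x by [].
  by rewrite E /= => /(side_int_not_vtx hr).
- move=> [k [k' [E1 E2]]]; have : (tri T `&` tri T') x by [].
  rewrite E2 => /(side_int_inj hr) ik; rewrite -{}ik in E1 *.
  have sE := sseg_same_ends E1; have hr' := same_ends_side_int sE hr.
  by rewrite -(side_int_inj hr' hs).
Qed.

Lemma same_ends_same_cell e e' : e.1 = e'.1 -> same_ends e e' -> e = e'.
Proof.
case: e e' => T i [T' j] /= <- h.
have r : side_int (T, i) (side_pt (T, i) 2^-1) by exists 2^-1 => //; apply/andP; split; lra.
congr pair; apply: (side_int_inj r); rewrite -(same_ends_sseg h); exact: side_int_sseg.
Qed.

(** Two triangles sharing a side lie on opposite sides of it: the quantity is the
    barycentric coordinate in the first triangle of the opposite vertex of the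
    second one. If it were positive, the points slightly off the midpoint of the
    side towards this vertex would belong to both triangles, but not to the common
    side. *)
Lemma same_ends_opposite e e' : e.1 != e'.1 -> same_ends e e' ->
  det2 (sb e - sa e) (sopp e' - sa e) / tdet e.1 < 0.
Proof.
case: e e' => T i [T' j] /= TT' se; rewrite -baryE.
set b := bary T i _.
have b0 : b != 0.
  rewrite /b baryE mulf_neq0 ?invr_eq0 ?tdet_neq0 //.
  have := tdet_neq0 T'; rewrite -(side_det T' j).
  move: se => /orP[] /andP[/eqP <- /eqP <-] //.
  set z := sopp _; apply: contra => /eqP h; apply/eqP; rewrite -[RHS]oppr0 -[in RHS]h.
  by rewrite /det2 !planeE; ring.
rewrite lt_neqAle b0 leNgt; apply/negP => bgt.
pose m := side_pt (T, i) 2^-1.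
have rm : side_int (T, i) m by exists 2^-1 => //; apply/andP; split; lra.
have sm' : sseg (T', j) m by rewrite -(same_ends_sseg se); exact: side_int_sseg.
(* Moving from m by the fraction c changes the two barycentric coordinates of m
   that equal 1 / 2 by less than that. *)
pose B := 2 + \sum_k `|bary T k (sopp (T', j))|.
have B2 : 2 <= B by rewrite /B lerDl sumr_ge0.
have Bk k : `|bary T k (sopp (T', j))| <= B - 2.
  by rewrite /B addrC addKr (bigD1 k) //= lerDl sumr_ge0.
pose c := (2 * B)^-1.
have c0 : 0 < c by rewrite invr_gt0; move: B2; lra.
have cB : c * (2 * B) = 1 by rewrite mulVf //; apply/eqP => h; move: B2 h; lra.
pose y := m + c *: (sopp (T', j) - m).
have yT : tri T y.
  apply: bary_ge0_tri => k; rewrite bary_affine /m bary_side.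
  have [->|ki] := eqVneq k i; first by rewrite add0r subr0 mulr_ge0 ?ltW.
  have h := Bk k; move: h; rewrite ler_norml => /andP[h _].
  by case: ifP => _; nra.
have yT' : tri T' y.
  apply: bary_ge0_tri => k; rewrite bary_affine.
  have m0 : 0 <= bary T' k m.
    move: sm' => /ssegP[t /andP[t0 t1] ->]; rewrite bary_side.
    by case: ifP => // _; case: ifP => _; lra.
  have s0 : 0 <= bary T' k (sopp (T', j)).
    have -> : sopp (T', j) = side_pt (T', j + 1) 1.
      rewrite /sopp /side_pt scale1r addrC subrK /sb /=; congr vtx.
      by move: (j); apply: ord3_ind; rewrite ?add3.
    by rewrite bary_side; case: ifP => // _; case: ifP => _; lra.
  by nra.
have mT : (tri T `&` tri T') m.
  split; last exact: (sseg_tri (e := (T', j))).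
  by apply: (sseg_tri (e := (T, i))); exact: side_int_sseg.
have yTT : (tri T `&` tri T') y by [].
have [_ _ _ /(_ T T' TT')] := meshO; case.
- by move=> TT0; move: mT; rewrite TT0.
- by move=> [k [k' [_ E]]]; move: mT; rewrite E /= => /(side_int_not_vtx rm).
- move=> [k [k' [_ E]]]; move: mT yTT; rewrite E => /(side_int_inj rm) <-.
  move=> /ssegP[t _] /(congr1 (bary T i)); rewrite bary_side eqxx bary_affine.
  by rewrite /m bary_side eqxx -/b => h; move: (mulr_gt0 c0 bgt) h; lra.
Qed.

Lemma sgr_div_lt0 (a b : R) : a / b < 0 -> Num.sg a = - Num.sg b.
Proof.
move=> h; have b0 : b != 0 by apply: contraTneq h => ->; rewrite invr0 mulr0 ltxx.
have := ltr0_sg h; rewrite sgrM sgrV => h1.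
have h2 : Num.sg b * Num.sg b = 1 by rewrite -expr2 sqr_sg b0.
by rewrite -[LHS]mulr1 -h2 mulrA h1 mulN1r.
Qed.

Lemma onormal_opp e e' : e.1 != e'.1 -> same_ends e e' -> onormal e' = - onormal e.
Proof.
move=> ee' se; have := same_ends_opposite ee' se.
case: e e' ee' se => T i [T' j] /= TT' se.
rewrite !onormalE ?tdet_neq0 // -(side_det T' j).
move: se => /orP[] /andP[/eqP -> /eqP ->].
  by move=> /sgr_div_lt0 ->; rewrite mulNr scaleNr.
set a := sa _; set b := sb _; set z := sopp _ => h.
have {h} -> : Num.sg (det2 (b - a) (z - a)) = Num.sg (tdet T).
  rewrite -[RHS]opprK; apply/eqP; rewrite -eqr_oppLR -sgrN; apply/eqP.
  apply: sgr_div_lt0; move: h; congr (_ / _ < _).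
  by rewrite /det2 !planeE; ring.
have -> : enorm (a - b) = enorm (b - a).
  by rewrite /enorm /dot !planeE; congr Num.sqrt; ring.
by apply: injective_projections; rewrite !planeE /=; ring.
Qed.

Lemma onormal_norm e : dot (onormal e) (onormal e) = 1.
Proof.
case: e => T i; rewrite onormalE ?tdet_neq0 //.
set t := sb _ - _; have t0 : t != 0 by exact: sa_neq_sb.
have n2 : enorm t ^+ 2 = dot t t by rewrite /enorm sqr_sqrtr ?dot_ge0.
have n0 : enorm t != 0 by rewrite enorm_eq0.
have -> : dot ((Num.sg (tdet T) / enorm t) *: (t.2, - t.1))
   ((Num.sg (tdet T) / enorm t) *: (t.2, - t.1)) =
   Num.sg (tdet T) ^+ 2 * dot t t / enorm t ^+ 2.
  by rewrite /dot !planeE /=; field.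
by rewrite sqr_sg tdet_neq0 mul1r -n2 divff // expf_neq0.
Qed.

Lemma onormal_orth e : dot (onormal e) (sb e - sa e) = 0.
Proof.
case: e => T i; rewrite onormalE ?tdet_neq0 //; set t := _ - _.
by rewrite /dot !planeE /=; ring.
Qed.

(** The normals of three triangles sharing a side would be pairwise opposite. *)
Lemma partner_unique e e' e'' : e.1 != e'.1 -> same_ends e e' ->
  e.1 != e''.1 -> same_ends e e'' -> e' = e''.
Proof.
move=> h1 s1 h2 s2.
have s3 : same_ends e' e'' by apply: same_ends_trans s2; rewrite same_ends_sym.
apply: same_ends_same_cell => //; apply/eqP/negPn/negP => h3.
have := onormal_opp h3 s3; rewrite (onormal_opp h1 s1) (onormal_opp h2 s2) opprK.
have := onormal_norm e; set n := onormal e => n1 nN.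
have : dot (- n) n = dot n n by rewrite nN.
by move: n1; rewrite /dot !planeE; lra.
Qed.

(** The boundary is a union of sides, so that it contains a side as soon as it
    contains a relative interior point of it. *)
Lemma side_int_Omega e x : ~ (sseg e `<=` bnd Omega) -> side_int e x -> Omega x.
Proof.
move=> hb hr; apply: contrapT => nO; apply: hb.
have [_ cO [B hB] _] := meshO.
have xB : bnd Omega x.
  split; last by move=> /interior_subset.
  by rewrite cO; exists e.1 => //; apply: sseg_tri; exact: side_int_sseg.
move: xB; rewrite hB => -[e' eB xe'].
by rewrite (same_ends_sseg (side_int_shared hr xe')) => y ye; exists e'.
Qed.

End MeshGeometry.

(** * Continuity of the normal component *)

Lemma cvg_sumr {R : realType} {T : Type} (F : set_system T) (FF : Filter F) (I : Type)
  (r : seq I) (P : pred I) (f : I -> T -> R) (a : I -> R) :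
  (forall i, P i -> f i x @[x --> F] --> a i) ->
  \sum_(i <- r | P i) f i x @[x --> F] --> \sum_(i <- r | P i) a i.
Proof.
move=> h; elim: r => [|i r IHr].
  by rewrite big_nil; under eq_fun do rewrite big_nil; exact: cvg_cst.
rewrite big_cons; under eq_fun do rewrite big_cons.
by case: ifP => // Pi; apply: cvgD => //; exact: h.
Qed.

(** Otherwise g >= g t / 2 > 0 on an interval around t. *)
Lemma integral_itv01_eq0 {R : realType} (g : R -> R) : continuous g -> (forall t, 0 <= g t) ->
  \int[lebesgue_measure]_(t in `[0, 1]) g t = 0 -> forall t, 0 < t < 1 -> g t = 0.
Proof.
move=> cg g0 ig0 t /andP[t0 t1].
apply/eqP/negPn/negP => gt0; have {}gt0 : 0 < g t by rewrite lt_neqAle eq_sym gt0 g0.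
have c0 : 0 < g t / 2 by rewrite divr_gt0.
have : \forall s \near t, g t / 2 <= g s.
  near=> s; apply/ltW; near: s.
  by apply: (cvgr_gt _ (cg t)); move: gt0; lra.
move=> /nbhs_ballP[d /= d0 hd].
pose a := Num.max 0 (t - d / 2); pose b := Num.min 1 (t + d / 2).
have ab : a < b by rewrite /a /b lt_min !gt_max; apply/andP; split; apply/andP; split; lra.
have sub : `[a, b]%classic `<=` `[0, 1]%classic.
  move=> s; rewrite /= !in_itv /= /a /b ge_max le_min => /andP[/andP[? _] /andP[? _]].
  by apply/andP.
have hab s : `[a, b]%classic s -> g t / 2 <= g s.
  rewrite /= in_itv /= /a /b ge_max le_min => /andP[/andP[_ ?] /andP[_ ?]].
  by apply: hd; rewrite /ball /= ltr_norml; apply/andP; split; lra.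
have i01 := continuous_itv_integrable 0 1 cg.
have : (0 < \int[lebesgue_measure]_(s in `[0%R, 1%R]) (g s)%:E)%E.
  apply: (@lt_le_trans _ _ (\int[lebesgue_measure]_(s in `[a, b]) (g t / 2)%R%:E)%E).
    rewrite integral_cst //= lebesgue_measure_itv /= lte_fin ab -EFinB -EFinM lte_fin.
    by rewrite mulr_gt0 // subr_gt0.
  apply: (@le_trans _ _ (\int[lebesgue_measure]_(s in `[a, b]) (g s)%:E)%E).
    apply: ge0_le_integral => //.
    - by move=> s _; rewrite lee_fin ltW.
    - by apply/measurable_EFinP; apply: measurable_funTS; exact: continuous_measurable_fun.
  apply: ge0_subset_integral => //.
  - by apply/measurable_EFinP; apply: measurable_funTS; exact: continuous_measurable_fun.
  - by move=> s _; rewrite lee_fin g0.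
rewrite -[X in (_ < X)%E]fineK; last exact: integrable_fin_num.
by rewrite -/(Rintegral _ _ _) ig0 ltxx.
Unshelve. all: by end_near.
Qed.

Lemma mean_sum {R : realType} (v w : R * R) (I : Type) (r : seq I) (P : pred I)
    (F : I -> R * R -> R) : (forall i, continuous (F i)) ->
  mean v w (fun x => \sum_(i <- r | P i) F i x) = \sum_(i <- r | P i) mean v w (F i).
Proof.
move=> cF; elim: r => [|i r IHr].
  rewrite big_nil /mean; under eq_Rintegral do rewrite big_nil.
  by rewrite Rintegral_cst ?mul0r //; exact: measurable_itv.
rewrite big_cons -IHr; case: ifP => Pi.
  rewrite -meanD //; last by move=> x; apply: cvg_sumr => j _; exact: cF.
  by apply: eq_Rintegral => t _; rewrite big_cons Pi.
by apply: eq_Rintegral => t _; rewrite big_cons Pi.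
Qed.

Section NormalContinuity.
Context {R : realType} (M : mesh R) (Omega : set (R * R)).
Local Notation cell := 'I_(ntri M).
Local Notation plane := (measurableTypeR R * measurableTypeR R)%type.
Hypothesis Omega_open : open Omega.
Hypothesis Omega_bounded : bounded_set Omega.
Hypothesis meshO : triangulates M Omega.
Variable p : cell -> R * R -> R * R.
Hypothesis p_C1 : forall T, C1 (fun x => (p T x).1) /\ C1 (fun x => (p T x).2).
Hypothesis p_Hdiv : Hdiv Omega p.
Implicit Types (T : cell) (x y : R * R) (e : side M) (phi : R * R -> R).

(** The flux density of p out of the triangle of e through e. *)
Definition outflux e x : R := dot (p e.1 x) (onormal e).

Lemma outflux_continuous e : continuous (outflux e).
Proof.
have [h1 h2] := p_C1 e.1; apply: C1_continuous; rewrite /outflux /dot.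
by apply: C1D; apply: C1M; [exact: h1|exact: C1_cst|exact: h2|exact: C1_cst].
Qed.

Lemma divergence_continuous T : continuous (divergence (p T)).
Proof.
have [[_ h1] [_ h2]] := p_C1 T => x.
by apply: cvgD; [exact: h1|exact: h2].
Qed.

(** The divergence theorem for the field phi p. *)
Lemma Green_mul T phi : C1 phi ->
  \sum_i lineint (sa (T, i)) (sb (T, i)) (fun x => phi x * outflux (T, i) x) =
  intT T (fun x => divergence (p T) x * phi x) +
  intT T (fun x => dot (p T x) (grad phi x)).
Proof.
move=> hphi; have [h1 h2] := p_C1 T.
have cphi := C1_continuous hphi.
have c1 := C1_continuous h1; have c2 := C1_continuous h2.
rewrite -intTD; last 2 first.
- by move=> x; apply: cvgM; [exact: divergence_continuous|exact: cphi].
- move: hphi => [_ cD] x.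
  apply: cvgD; apply: cvgM; [exact: c1|exact: cD|exact: c2|exact: cD].
have := Green_tri (tdet_neq0 meshO T) (C1M hphi h1) (C1M hphi h2).
rewrite (_ : (fun x => _ + _) = (fun x => divergence (p T) x * phi x + dot (p T x) (grad phi x))).
  move=> ->; apply: eq_bigr => i _; congr lineint; apply/funext => x.
  by rewrite /outflux /dot /=; ring.
apply/funext => x; move: hphi h1 h2 => [dphi _] [d1 _] [d2 _].
rewrite !deriveMf // /divergence /dot /grad /=; ring.
Qed.

Lemma sseg_closed e : closed (sseg e).
Proof.
apply: compact_closed; first exact: norm_hausdorff.
rewrite /sseg /seg; apply: continuous_compact; last exact: segment_compact.
apply: continuous_subspaceT => t.
by apply: cvgD; [exact: cvg_cst|apply: cvgZ; [exact: cvg_id|exact: cvg_cst]].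
Qed.

Lemma lineint_same_ends e e' phi : continuous phi -> same_ends e e' ->
  lineint (sa e') (sb e') phi = lineint (sa e) (sb e) phi.
Proof.
move=> cphi /orP[] /andP[/eqP -> /eqP ->] //; rewrite !lineintE mean_sym //.
by congr (_ * _); rewrite /enorm /dot !planeE; congr Num.sqrt; ring.
Qed.

(** The net flux out of all the triangles having the segment of e as a side. *)
(** The net flux out of all the triangles having the segment of e as a side. *)
Definition flux e x : R := \sum_(e' | same_ends e e') outflux e' x.

Lemma flux_continuous e : continuous (flux e).
Proof.
move=> x; apply: cvg_sumr => e' _; exact: outflux_continuous.
Qed.


Lemma coord_le_dot x (d : R) : 0 <= d -> dot x x <= d ^+ 2 -> `|x| <= d.
Proof.
move=> d0 h; rewrite prod_normE ge_max; move: h; rewrite /dot -!expr2 => h.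
by apply/andP; split; rewrite -(ler_pXn2r (n := 2)) ?nnegrE // real_normK ?num_real //;
  rewrite (le_trans _ h) // ?lerDl ?lerDr sqr_ge0.
Qed.

Lemma spike_C1c x0 l (d : R) n : 0 <= d ->
  (forall x, dot (x - x0) (x - x0) <= d ^+ 2 -> Omega x) -> C1c Omega (spike x0 l d n).
Proof.
move=> d0 hO; have [h1 h2] := spike_C1 x0 l d n; split=> //.
exists [set x | dot (x - x0) (x - x0) <= d ^+ 2]; split=> //; last first.
  by move=> x /negP; rewrite -ltNge => /ltW; exact: spike_far.
have c : continuous (fun x => dot (x - x0) (x - x0)).
  have c1 : C1 (fun x => (x - x0).1).
    by apply: C1_ext (C1D C1_fst (C1_cst (- x0.1))) => x; rewrite !planeE.
  have c2 : C1 (fun x => (x - x0).2).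
    by apply: C1_ext (C1D C1_snd (C1_cst (- x0.2))) => x; rewrite !planeE.
  by apply: C1_continuous; rewrite /dot; apply: C1D; apply: C1M.
apply: (@subclosed_compact _ _ ((`[x0.1 - d, x0.1 + d]%classic : set R) `*`
    (`[x0.2 - d, x0.2 + d]%classic : set R))).
- by apply: (closed_comp (f := fun x => dot (x - x0) (x - x0))
    (D := [set z | z <= d ^+ 2])) => [x _|]; [exact: c|exact: closed_le].
- by apply: compact_setX; exact: segment_compact.
- move=> x /(coord_le_dot d0); rewrite prod_normE ge_max !planeE !ler_norml.
  by move=> /andP[/andP[? ?] /andP[? ?]]; split; rewrite /= in_itv /=; apply/andP; split; lra.
Qed.

(** Omega has finite area, and |g| <= 1 + g^2. *)
Lemma integrable_of_sq (g : R * R -> R) : measurable_fun Omega (g : plane -> R) ->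
  area.-integrable Omega (fun x => (g x ^+ 2)%:E) -> area.-integrable Omega (EFin \o g).
Proof.
move=> mg ig.
have mO : measurable (Omega : set plane) by exact: open_measurable_plane.
have i1 : area.-integrable Omega (EFin \o cst (1 : R)).
  apply: measurable_bounded_integrable => //; first exact: bounded_area.
  by exists 1; split=> // x x1 y _; rewrite /cst normr1 ltW.
apply: le_integrable (integrableD mO i1 ig) => //; first exact/measurable_EFinP.
move=> x _; rewrite /= lee_fin [X in _ <= X]ger0_norm ?addr_ge0 ?sqr_ge0 //.
by rewrite ler_norml; apply/andP; split; nra.
Qed.

(** Testing the weak divergence with spikes around e leaves only the flux on e
    in the limit. *)
(** The weak divergence is tested with the spikes around e. By the divergence
    theorem on all the triangles the left-hand side equals, for every n, a sum of
    volume integrals against the n-th spike, and these tend to zero. The spike with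
    normal 0 serves as the common restriction of all of them to e. *)
Lemma spike_flux e x0 (d : R) : side_int e x0 -> 0 <= d ->
  (forall x, dot (x - x0) (x - x0) <= d ^+ 2 -> Omega x) ->
  (forall e' x, ~ sseg e' x0 -> sseg e' x -> d ^+ 2 <= dot (x - x0) (x - x0)) ->
  mean (sa e) (sb e) (fun x => spike x0 0 d 0 x * flux e x) = 0.
Proof.
move=> re d0 hO hd.
have [g [mg ig hg]] := p_Hdiv.
have mO : measurable (Omega : set plane) by exact: open_measurable_plane.
pose t := sb e - sa e; pose l := (t.2, - t.1).
have l0 : l != 0.
  have : t != 0 by exact: (sa_neq_sb meshO).
  by apply: contra => /eqP[] h1 /eqP; rewrite oppr_eq0 => /eqP h2; apply/eqP/injective_projections.
have sline x : sseg e x -> dot l (x - x0) = 0.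
  move=> /ssegP[s _ ->]; have [s0 _ ->] := re.
  by rewrite /side_pt -/t /dot !planeE /=; ring.
have sp0 n x : sseg e x -> spike x0 l d n x = spike x0 0 d 0 x.
  by move=> /sline h; rewrite spike_line // /spike !mul0r.
have csp l' n := C1_continuous (spike_C1 x0 l' d n).
have line n e' : lineint (sa e') (sb e') (fun x => spike x0 l d n x * outflux e' x) =
    if same_ends e e' then lineint (sa e) (sb e) (fun x => spike x0 0 d 0 x * outflux e' x)
    else 0.
  case: ifPn => se.
    rewrite (lineint_same_ends (e := e)) //; last first.
      by move=> x; apply: cvgM; [exact: csp|exact: outflux_continuous].
    rewrite !lineintE; congr (_ * _); apply: eq_Rintegral => s.
    rewrite inE /= in_itv /= => s01; rewrite sp0 //.
    by apply/ssegP; exists s.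
  rewrite lineintE /mean (_ : Rintegral _ _ _ = 0) ?mulr0 //.
  transitivity (\int[@lebesgue_measure R]_(s in `[0, 1]) (0 : R)); last first.
    by rewrite Rintegral_cst ?mul0r //; exact: measurable_itv.
  apply: eq_Rintegral => s; rewrite inE /= in_itv /= => s01.
  rewrite spike_far ?mul0r //; apply: (hd e').
    by move=> /(side_int_shared meshO re); exact/negP.
  by apply/ssegP; exists s.
have cO : continuous (fun x => spike x0 0 d 0 x * flux e x).
  by move=> x; apply: cvgM; [exact: csp|exact: flux_continuous].
(* So the left-hand side, which tends to zero, does not depend on n. *)
have Lsum n : \sum_T (intT T (fun x => divergence (p T) x * spike x0 l d n x)) -
    \int[area]_(x in Omega) (g x * spike x0 l d n x) =
    lineint (sa e) (sb e) (fun x => spike x0 0 d 0 x * flux e x).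
  rewrite -(hg _ (spike_C1c l n d0 hO)) -big_split /=.
  under eq_bigr => T _ do rewrite -(Green_mul T (spike_C1 x0 l d n)).
  rewrite pair_big /=; transitivity (\sum_(e' : side M)
    lineint (sa e') (sb e') (fun x => spike x0 l d n x * outflux e' x)).
    by apply: eq_bigr => -[].
  under eq_bigr do rewrite line.
  rewrite -big_mkcond /= lineintE.
  under eq_bigr do rewrite lineintE.
  rewrite -mulr_sumr; congr (_ * _).
  have cn e' : continuous (fun x => spike x0 0 d 0 x * outflux e' x).
    by move=> x; apply: cvgM; [exact: csp|exact: outflux_continuous].
  rewrite -mean_sum //; congr mean; apply/funext => x.
  by rewrite /flux mulr_sumr.
have : (fun n => \sum_T (intT T (fun x => divergence (p T) x * spike x0 l d n x)) -
    \int[area]_(x in Omega) (g x * spike x0 l d n x)) @ \oo --> \sum_(T : cell) (0 : R) - 0.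
  apply: cvgB.
    apply: cvg_sumr => T _; apply: integral_spike_cvg => //.
      by apply: compact_measurable_plane; exact: tri_compact.
    by apply: integrable_tri; exact: divergence_continuous.
  by apply: integral_spike_cvg => //; exact: integrable_of_sq.
under eq_fun do rewrite Lsum.
rewrite big1 // subr0 => /(cvg_unique _ (cvg_cst _)) => /(_ (@norm_hausdorff _ _)).
move=> /eqP; rewrite lineintE mulf_eq0 enorm_eq0 (negPf (sa_neq_sb meshO e)) /= => /eqP.
by [].
Qed.

(** If the flux did not vanish at x0, it would have a constant sign on a small
    disk about x0, and its integral against a spike supported there would not
    vanish. *)
Lemma flux_eq0 e x0 : side_int e x0 -> Omega x0 -> flux e x0 = 0.
Proof.
move=> re O0; apply/eqP/negPn/negP => f0.
have f2 : 0 < flux e x0 * flux e x0 by rewrite -expr2 exprn_even_gt0.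
have : \forall x \near x0, [/\ Omega x, 0 < flux e x0 * flux e x
    & forall e', ~ sseg e' x0 -> ~ sseg e' x].
  have nO : \forall x \near x0, Omega x by exact: open_nbhs_nbhs.
  have nf : \forall x \near x0, 0 < flux e x0 * flux e x.
    have cf : flux e x0 * flux e x @[x --> x0] --> flux e x0 * flux e x0.
      by apply: cvgM; [exact: cvg_cst|exact: flux_continuous].
    exact: (cvgr_gt _ cf).
  have ns : \forall x \near x0, forall e' : side M, ~ sseg e' x0 -> ~ sseg e' x.
    pose f (e' : cell * 'I_3) := [set x | ~ sseg (e' : side M) x0 -> ~ sseg (e' : side M) x].
    suff H e' : \forall x \near x0, f e' x.
      exact: (@filter_forall _ (cell * 'I_3)%type f (nbhs x0) (nbhs_filter x0) H).
    rewrite /f; have [h|h] := pselect (sseg (e' : side M) x0); first by near=> x.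
    have : nbhs x0 (~` sseg (e' : side M)).
      by apply: open_nbhs_nbhs; split=> //; exact/closed_openC/sseg_closed.
    by apply: filterS => x hx _.
  by near=> x; split; near: x.
move=> /nbhs_ballP[r /= r0 hr].
(* Balls refer to the maximum norm, supports of spikes to the Euclidean one,
   which is the larger of the two. *)
pose d := r / 2; have d0 : 0 < d by rewrite /d divr_gt0.
have hd x : dot (x - x0) (x - x0) <= d ^+ 2 -> ball x0 r x.
  move=> /(coord_le_dot (ltW d0)) h.
  by rewrite -ball_normE /= distrC (le_lt_trans h) // /d; move: r0; lra.
have hO x : dot (x - x0) (x - x0) <= d ^+ 2 -> Omega x by move=> /hd /hr[].
have hs e' x : ~ sseg e' x0 -> sseg e' x -> d ^+ 2 <= dot (x - x0) (x - x0).
  by move=> n0 nx; rewrite leNgt; apply/negP => /ltW /hd /hr[_ _ /(_ e' n0)].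
have := spike_flux re (ltW d0) hO hs.
pose psi x := flux e x0 * (spike x0 0 d 0 x * flux e x).
have csf : continuous (fun x => spike x0 0 d 0 x * flux e x).
  move=> x; apply: cvgM; last exact: flux_continuous.
  exact: (C1_continuous (spike_C1 x0 0 d 0)).
have cpsi : continuous psi by move=> x; apply: cvgM; [exact: cvg_cst|exact: csf].
move=> /(congr1 ( *%R (flux e x0))); rewrite -meanZ // mulr0 -/psi => m0.
have psi0 x : 0 <= psi x.
  rewrite /psi; have [h|h] := leP (dot (x - x0) (x - x0)) (d ^+ 2).
    have [_ h1 _] := hr _ (hd _ h).
    by rewrite mulrCA mulr_ge0 ?spike_ge0 // ltW.
  by rewrite (spike_far _ _ (ltW h)) mul0r mulr0.
have [t t01 x0t] := re.
have := integral_itv01_eq0 (continuous_line (v := sa e) (w := sb e - sa e) cpsi)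
  (fun t => psi0 _) m0 t01.
rewrite -/(side_pt e t) -x0t /psi /spike subrr /dot /= !mul0r !addr0 !subr0.
rewrite mulrCA => /eqP; rewrite mulf_eq0 (gt_eqF f2) orbF /sqpos.
have d2 : 0 < d ^+ 2 by rewrite exprn_gt0.
by rewrite (max_idPr (ltW d2)) expf_eq0 /= (gt_eqF d2).
Unshelve. all: by end_near.
Qed.

End NormalContinuity.

(** * Integration by parts over the mesh *)

Lemma mean_eq {R : realType} (v w : R * R) (f g : R * R -> R) :
  continuous f -> continuous g ->
  (forall t, 0 < t < 1 -> f (v + t *: (w - v)) = g (v + t *: (w - v))) ->
  mean v w f = mean v w g.
Proof.
move=> cf cg fg; rewrite /mean.
have H (h : R * R -> R) : continuous h ->
    \int[lebesgue_measure]_(t in `[0, 1]) h (v + t *: (w - v)) =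
    \int[lebesgue_measure]_(t in `]0, 1[) h (v + t *: (w - v)).
  move=> ch; have ig := continuous_itv_integrable 0 1 (continuous_line (v := v) (w := w - v) ch).
  rewrite -Rintegral_itv_obnd_cbnd; last first.
    apply: integrableS ig => //; exact: subset_itv_oc_cc.
  rewrite -Rintegral_itv_bndo_bndc //.
  apply: integrableS ig => //; exact: subset_itv_oo_cc.
rewrite !H //; apply: eq_Rintegral => t; rewrite inE /= in_itv /= => t01.
exact: fg.
Qed.

Section IntegrationByParts.
Context {R : realType} (M : mesh R) (Omega : set (R * R)).
Local Notation cell := 'I_(ntri M).
Local Notation side := (side M).
Hypothesis Omega_open : open Omega.
Hypothesis Omega_bounded : bounded_set Omega.
Hypothesis meshO : triangulates M Omega.
Variables (nE : edge M -> R * R) (n : nat).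
Hypothesis nE_normal : edge_normals Omega nE.
Variables (p : cell -> R * R -> R * R) (u : cell -> R * R -> R).
Hypothesis p_RT0 : RT0 n Omega p.
Hypothesis u_C1 : forall T, C1 (u T).
Implicit Types (e : side) (E : edge M).

Lemma RTloc_C1 m (q : R * R -> R * R) : RTloc m q ->
  C1 (fun x => (q x).1) /\ C1 (fun x => (q x).2).
Proof.
move=> [a [g [[a1 a2] hg h]]]; split.
  by apply: C1_ext (C1D (Pol_C1 a1) (C1M (Pol_C1 hg) C1_fst)) => x; rewrite h !planeE.
by apply: C1_ext (C1D (Pol_C1 a2) (C1M (Pol_C1 hg) C1_snd)) => x; rewrite h !planeE.
Qed.

Let p_C1 T : C1 (fun x => (p T x).1) /\ C1 (fun x => (p T x).2).
Proof. by have [[h _] _] := p_RT0; exact: RTloc_C1 (h T). Qed.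

Let p_Hdiv : Hdiv Omega p. Proof. by have [[_ h] _] := p_RT0. Qed.

(** Vectors of the plane orthogonal to t are multiples of each other, so that b
    is its own projection onto a. *)
Lemma unit_normal_dot (t a b v : R * R) : t != 0 -> dot a t = 0 -> dot b t = 0 ->
  dot a a = 1 -> dot v a * dot b a = dot v b.
Proof.
move=> t0; rewrite /dot => ha hb a1.
have D : a.1 * b.2 - a.2 * b.1 = 0.
  have h1 : (a.1 * b.2 - a.2 * b.1) * t.1 = 0.
    have -> : (a.1 * b.2 - a.2 * b.1) * t.1 =
      (a.1 * t.1 + a.2 * t.2) * b.2 - a.2 * (b.1 * t.1 + b.2 * t.2) by ring.
    by rewrite ha hb; ring.
  have h2 : (a.1 * b.2 - a.2 * b.1) * t.2 = 0.
    have -> : (a.1 * b.2 - a.2 * b.1) * t.2 =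
      a.1 * (b.1 * t.1 + b.2 * t.2) - (a.1 * t.1 + a.2 * t.2) * b.1 by ring.
    by rewrite ha hb; ring.
  apply/eqP; apply: contraNT t0 => D0; apply/eqP/injective_projections.
    by move: h1 => /eqP; rewrite mulf_eq0 (negPf D0) => /eqP.
  by move: h2 => /eqP; rewrite mulf_eq0 (negPf D0) => /eqP.
have -> : (v.1 * a.1 + v.2 * a.2) * (b.1 * a.1 + b.2 * a.2) =
  (v.1 * b.1 + v.2 * b.2) * (a.1 * a.1 + a.2 * a.2) +
  (a.1 * b.2 - a.2 * b.1) * (v.1 * a.2 - v.2 * a.1) by ring.
by rewrite D a1; ring.
Qed.

(** The boundary term of the side e in the integration by parts. *)
Let side_term e := lineint (sa e) (sb e) (fun x => u e.1 x * outflux p e x).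

Lemma side_term_continuous e e' : continuous (fun x => u e.1 x * outflux p e' x).
Proof.
by move=> x; apply: cvgM; [exact: (C1_continuous (u_C1 e.1))|exact: outflux_continuous].
Qed.

Lemma side_term_bnd e : sseg e `<=` bnd Omega -> side_term e = 0.
Proof.
move=> he; rewrite /side_term lineintE.
rewrite (@mean_eq _ _ _ _ (fun x => 0 * u e.1 x)).
- rewrite meanZ ?mul0r ?mulr0 //; exact: (C1_continuous (u_C1 e.1)).
- exact: side_term_continuous.
- by move=> x; apply: cvgM; [exact: cvg_cst|exact: (C1_continuous (u_C1 e.1))].
move=> t /andP[t0 t1]; rewrite mul0r.
have [_ h] := p_RT0; rewrite /outflux (h e) ?mulr0 //.
by apply/ssegP; exists t; rewrite // !ltW.
Qed.

Definition partner e : pred side := fun e' => same_ends e e' && (e.1 != e'.1).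

Lemma flux_partner e x : flux p e x = outflux p e x + \sum_(e' | partner e e') outflux p e' x.
Proof.
rewrite /flux (bigD1 e) /=; last by rewrite /same_ends !eqxx.
congr (_ + _); apply: eq_bigl => e'; rewrite /partner; apply: andb_id2l => se.
apply/idP/idP; apply: contraNN => /eqP h; last by rewrite h.
by rewrite (same_ends_same_cell meshO h se).
Qed.

(** A side off the boundary has at most one partner; if it has none, its own flux
    vanishes by flux_eq0. *)
Lemma side_term_partner e : ~ (sseg e `<=` bnd Omega) ->
  side_term e = \sum_(e' | partner e e') side_term e.
Proof.
move=> he; have [e' pe'|np] := pickP (partner e).
  rewrite (bigD1 e') //= big1 ?addr0 // => e'' /andP[/andP[s2 h2] /negP ne].
  case: ne; move: pe' => /andP[s1 h1]; apply/eqP.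
  exact: (partner_unique meshO h2 s2 h1 s1).
rewrite big_pred0 // /side_term lineintE (@mean_eq _ _ _ _ (fun x => 0 * u e.1 x)).
- rewrite meanZ ?mul0r ?mulr0 //; exact: (C1_continuous (u_C1 e.1)).
- exact: side_term_continuous.
- by move=> x; apply: cvgM; [exact: cvg_cst|exact: (C1_continuous (u_C1 e.1))].
move=> t t01; rewrite mul0r.
have re : side_int e (side_pt e t) by exists t.
have := flux_eq0 Omega_open Omega_bounded meshO p_C1 p_Hdiv re (side_int_Omega meshO he re).
by rewrite flux_partner big_pred0 // addr0 => ->; rewrite mulr0.
Qed.

(** On the edge the outward fluxes of p from the two triangles cancel, the outer
    normals are opposite and n_E is one of them. *)
Lemma side_term_iedge E : E \in iedges M Omega ->
  intE E (fun x => ntrace nE p E x * jump nE u E x) = side_term E.1 + side_term E.2.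
Proof.
case: E => e1 e2 EI; have [nE1 nE2] := nE_normal EI.
move: EI; rewrite inE /= => /and3P[lt12 se /asboolPn hb].
have ne : e1.1 != e2.1 by rewrite neq_ltn lt12.
have pe : partner e1 e2 by rewrite /partner se ne.
have on := onormal_opp meshO ne se.
have dn : dot (nE (e1, e2)) (nE (e1, e2)) = 1.
  by rewrite -(sqr_sqrtr (dot_ge0 (nE (e1, e2)))) -/(enorm (nE (e1, e2))) nE1 expr1n.
have key t : 0 < t < 1 -> let x := side_pt e1 t in
    ntrace nE p (e1, e2) x * jump nE u (e1, e2) x =
    u e1.1 x * outflux p e1 x + u e2.1 x * outflux p e2 x.
  move=> t01 x; have re : side_int e1 x by exists t.
  have := flux_eq0 Omega_open Omega_bounded meshO p_C1 p_Hdiv re (side_int_Omega meshO hb re).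
  rewrite flux_partner (bigD1 e2) //= big1 ?addr0; last first.
    move=> e'' /andP[/andP[s2 h2] /negP[]]; apply/eqP.
    exact: (partner_unique meshO h2 s2 ne se).
  move=> fl; have n2 : outflux p e2 x = - outflux p e1 x by move: fl; lra.
  have U := unit_normal_dot (p e1.1 x) (sa_neq_sb meshO e1) nE2 (onormal_orth meshO e1) dn.
  rewrite n2 /ntrace /jump /= on /outflux -U.
  by rewrite /dot !planeE; ring.
have c1 : continuous (fun x => ntrace nE p (e1, e2) x * jump nE u (e1, e2) x).
  apply: C1_continuous; apply: C1M.
    have [h1 h2] := p_C1 e1.1; rewrite /ntrace /dot /=.
    by apply: C1D; apply: C1M; [exact: h1|exact: C1_cst|exact: h2|exact: C1_cst].
  rewrite /jump /=; set m := nE _.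
  apply: C1_ext (C1D (C1M (u_C1 e1.1) (C1_cst (dot (onormal e1) m)))
    (C1M (u_C1 e2.1) (C1_cst (dot (onormal e2) m)))) => x.
  by rewrite /dot !planeE; ring.
have E2 : side_term e2 = lineint (sa e1) (sb e1) (fun x => u e2.1 x * outflux p e2 x).
  by rewrite /side_term (lineint_same_ends _ se) //; exact: side_term_continuous.
rewrite /= E2 /side_term /intE !lineintE -mulrDr /= -meanD;
  [|exact: side_term_continuous..].
congr (_ * _); apply: mean_eq => //.
by move=> x; apply: cvgD; exact: side_term_continuous.
Qed.

(** Every term off the boundary is counted once for each partner, so the sum runs
    over ordered pairs of partners; these are grouped by the order of the indices
    of their triangles. *)
Lemma sum_side_term : \sum_e side_term e =
  \sum_(E in iedges M Omega) intE E (fun x => ntrace nE p E x * jump nE u E x).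
Proof.
rewrite [RHS](eq_bigr (fun E => side_term E.1 + side_term E.2)); last first.
  by move=> E; exact: side_term_iedge.
pose I e := ~~ `[< sseg e `<=` bnd Omega >].
have Ise e e' : same_ends e e' -> I e = I e'.
  by move=> se; rewrite /I (same_ends_sseg se).
rewrite (bigID I) /= [X in _ + X = _]big1 ?addr0; last first.
  by move=> e /negPn /asboolP; exact: side_term_bnd.
rewrite (eq_bigr (fun e => \sum_(e' | partner e e') side_term e)); last first.
  by move=> e /asboolPn; exact: side_term_partner.
rewrite pair_big_dep /= big_split /=.
rewrite (bigID (fun E => (E.1.1 < E.2.1)%N)) /=; congr (_ + _).
  apply: eq_bigl => -[e e']; rewrite inE /= /partner /I.
  case: ltnP => h; rewrite ?andbF ?andbT //=.
  rewrite andbC; case: same_ends => //=.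
  by rewrite (_ : e.1 != e'.1) // neq_ltn h.
rewrite (reindex_inj (h := fun E : edge M => (E.2, E.1))) /=; last by move=> [? ?] [? ?] [-> ->].
apply: eq_bigl => -[e e']; rewrite inE /= /partner -leqNgt (same_ends_sym e').
have [h|h] := ltnP e.1 e'.1; last first.
  rewrite /=; apply/negbTE/negP => /andP[/andP[_ /andP[_ ne]] h'].
  by move: ne; rewrite neq_ltn !ltnNge h h'.
rewrite ltnW // andbT /=; have [se|] := boolP (same_ends e e'); last by rewrite andbF.
by rewrite -(Ise _ _ se) /= neq_ltn h orbT andbT.
Qed.

(** The adjoint of - Lambda is the divergence. *)
Lemma pairing_Lam :
  - pairing Omega nE p (Lam nE u) = \sum_T intT T (fun x => divergence (p T) x * u T x).
Proof.
rewrite /pairing opprB -sum_side_term.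
rewrite (_ : \sum_e side_term e = \sum_(T : cell) \sum_i side_term (T, i)); last first.
  by rewrite pair_big; apply: eq_bigr => -[].
under eq_bigr => T _ do rewrite (Green_mul meshO p_C1 T (u_C1 T)).
by rewrite big_split /= addrK.
Qed.

End IntegrationByParts.

(** * Interpolation on triangles *)

Section Interpolation.
Context {R : realType} (M : mesh R).
Local Notation cell := 'I_(ntri M).
Local Notation basis := Defs.basis.
Implicit Types (T : cell) (f g : R * R -> R) (n : nat).

Lemma Pol_ext n f g : (forall x, f x = g x) -> Pol n f -> Pol n g.
Proof. by move=> fg; have -> : g = f by apply/funext. Qed.

Lemma PolD n f g : Pol n f -> Pol n g -> Pol n (fun x => f x + g x).
Proof.
move=> [c hc] [d hd]; exists (fun i j => c i j + d i j) => x.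
rewrite hc hd -big_split; apply: eq_bigr => i _.
by rewrite -big_split; apply: eq_bigr => j _; rewrite /= !mulrDl.
Qed.

Lemma PolZ n f (a : R) : Pol n f -> Pol n (fun x => a * f x).
Proof.
move=> [c hc]; exists (fun i j => a * c i j) => x.
rewrite hc mulr_sumr; apply: eq_bigr => i _.
by rewrite mulr_sumr; apply: eq_bigr => j _; rewrite !mulrA.
Qed.

Lemma Pol0 n : Pol n (fun _ : R * R => 0).
Proof.
by exists (fun _ _ => 0) => x; rewrite big1 // => i _; rewrite big1 // => j _; rewrite !mul0r.
Qed.

Lemma Pol_succ n f : Pol n f -> Pol n.+1 f.
Proof.
move=> [c hc]; exists (fun i j => if (i + j < n)%N then c i j else 0) => x.
rewrite big_ord_recr /= [X in _ + X]big1 ?addr0; last first.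
  by move=> j _; rewrite ltnNge leq_addr !mul0r.
rewrite hc; apply: eq_bigr => i _; rewrite subSn ?(ltnW (ltn_ord i)) // big_ord_recr /=.
rewrite subnKC ?(ltnW (ltn_ord i)) // ltnn !mul0r addr0.
by apply: eq_bigr => j _; rewrite -ltn_subRL ltn_ord.
Qed.

Lemma Pol_mulX n f : Pol n f -> Pol n.+1 (fun x => x.1 * f x).
Proof.
move=> [c hc]; exists (fun i j => if i is i'.+1 then c i' j else 0) => x.
rewrite big_ord_recl /= big1 ?add0r; last by move=> j _; rewrite !mul0r.
rewrite hc mulr_sumr; apply: eq_bigr => i _; rewrite /= mulr_sumr.
by apply: eq_bigr => j _; rewrite /bump /= exprS; ring.
Qed.

Lemma Pol_mulY n f : Pol n f -> Pol n.+1 (fun x => x.2 * f x).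
Proof.
move=> [c hc]; exists (fun i j => if j is j'.+1 then c i j' else 0) => x.
rewrite big_ord_recr /= [X in _ + X]big1 ?addr0; last first.
  by rewrite subSn // subnn => j _; rewrite ord1 !mul0r.
rewrite hc mulr_sumr; apply: eq_bigr => i _.
rewrite subSn ?(ltnW (ltn_ord i)) // big_ord_recl /= !mul0r add0r mulr_sumr.
by apply: eq_bigr => j _; rewrite /bump /= exprS; ring.
Qed.

Lemma Pol_mul_affine n f (a b c : R) : Pol n f ->
  Pol n.+1 (fun x => (a + b * x.1 + c * x.2) * f x).
Proof.
move=> hf; apply: Pol_ext (PolD (PolD (PolZ a (Pol_succ hf)) (PolZ b (Pol_mulX hf)))
  (PolZ c (Pol_mulY hf))) => x; ring.
Qed.

Lemma Pol_cst (a : R) : Pol 1 (fun _ => a).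
Proof.
exists (fun _ _ => a) => x.
by rewrite big_ord_recl big_ord0 subn0 big_ord_recl big_ord0 /= !expr0 !mulr1 !addr0.
Qed.

Lemma bary_is_affine T i : tdet T != 0 ->
  exists a b c : R, forall x, bary T i x = a + b * x.1 + c * x.2.
Proof.
move=> d0; pose t := sb (T, i) - sa (T, i); pose d := det2 (sopp (T, i) - sa (T, i)) t.
exists ((- (sa (T, i)).1 * t.2 + (sa (T, i)).2 * t.1) / d), (t.2 / d), (- t.1 / d) => x.
by rewrite /bary -/t -/d /det2 !planeE; ring.
Qed.

(** A basis function is a product of n - 1 affine functions, because the three
    lattice indices of a node add up to n - 1. *)
Lemma basis_Pol T n (k : lat n) : tdet T != 0 -> Pol n (basis T k).
Proof.
move=> d0.
have hprod (l : 'I_3) m r f : Pol m.+1 f ->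
    Pol (m + r).+1 (fun x => (\prod_(a < r)
      ((n.-1%:R * bary T l x - a%:R) / ((lat3 k l)%:R - a%:R))) * f x).
  move=> hf; elim: r => [|r IHr].
    by rewrite addn0; apply: Pol_ext hf => x; rewrite big_ord0 mul1r.
  have [a [b [c hb]]] := bary_is_affine l d0.
  pose w := (lat3 k l)%:R - r%:R : R.
  rewrite addnS; apply: Pol_ext (Pol_mul_affine ((n.-1%:R * a - r%:R) / w)
    (n.-1%:R * b / w) (n.-1%:R * c / w) IHr) => x.
  by rewrite big_ord_recr /= hb -/w; ring.
have := hprod 0 _ (lat3 k 0) _ (hprod 1 _ (lat3 k 1) _
  (hprod 2%:R 0%N (lat3 k 2%:R) _ (Pol_cst 1))).
have hs : n.-1 = lat3 k 0 + lat3 k 1 + lat3 k 2%:R by rewrite -(sum_lat3 k) -sum3.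
have -> : (0 + lat3 k 2%:R%R + lat3 k 1%R + lat3 k 0%R)%N = n.-1.
  by rewrite hs add0n -[RHS]/(_ + _ + _)%N; lia.
rewrite prednK; last by case: (val k) => -[i hi] _; exact: leq_ltn_trans hi.
apply: Pol_ext => x; rewrite mulr1 /basis !big_ord_recl big_ord0 mulr1.
have -> : lift ord0 ord0 = 1 :> 'I_3 by apply/val_inj.
have -> : lift ord0 (lift ord0 ord0) = 2%:R :> 'I_3 by apply/val_inj.
by have -> : ord0 = 0 :> 'I_3 by apply/val_inj.
Qed.

(** The monomials of degree less than n are indexed by the lattice points. *)
Lemma Pol_lat n f : Pol n f -> exists c : lat n -> R, forall x,
  f x = \sum_k c k * (x.1 ^+ (val k).1 * x.2 ^+ (val k).2).
Proof.
move=> [c hc]; exists (fun k : lat n => c (val k).1 (val k).2) => x.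
rewrite hc; pose F (i j : nat) := c i j * (x.1 ^+ i * x.2 ^+ j).
transitivity (\sum_(i < n) \sum_(j < n | (j < n - i)%N) F i j).
  apply: eq_bigr => i _; rewrite -(big_ord_widen n (F i)) ?leq_subr //.
  by apply: eq_bigr => j _; rewrite /F mulrA.
rewrite pair_big_dep /=.
rewrite (reindex_omap (val : lat n -> _) insub) /=; last first.
  by move=> [i j]; rewrite ltn_subRL /= => h; rewrite insubT.
apply: eq_big => // k; rewrite valK eqxx andbT ltn_subRL.
by case: k => -[i j] /= ->.
Qed.

(** The lattice points index both the nodes and the monomials, so the values of
    the monomials at the nodes form a square matrix V. The coefficients C of the
    nodal basis satisfy C V = 1, whence V C = 1, which says that every polynomial
    is recovered from its nodal values. *)
Lemma interp_id T n f : tdet T != 0 -> Pol n f -> forall x, interp T n f x = f x.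
Proof.
move=> d0 hf x.
pose N := #|{: lat n}|.
pose mono (k : lat n) (y : R * R) := y.1 ^+ (val k).1 * y.2 ^+ (val k).2.
have cB (k : lat n) : {c : lat n -> R | forall y, basis T k y = \sum_k' c k' * mono k' y}.
  by apply/cid; exact: Pol_lat (basis_Pol k d0).
pose C := \matrix_(i < N, j < N) (sval (cB (enum_val i)) (enum_val j)).
pose V := \matrix_(i < N, j < N) (mono (enum_val i) (node T (enum_val j))).
have sumE (F : lat n -> R) : \sum_k F k = \sum_(i < N) F (enum_val i).
  by rewrite (reindex (enum_val : 'I_N -> lat n)) //; apply: onW_bij; exact: enum_val_bij.
have CV : C *m V = 1%:M.
  apply/matrixP => i j; rewrite !mxE.
  under eq_bigr do rewrite !mxE.
  rewrite -(sumE (fun k => sval (cB (enum_val i)) k * mono k (node T (enum_val j)))).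
  rewrite -(svalP (cB (enum_val i))) basis_node // (inj_eq enum_val_inj).
  by [].
have VC := mulmx1C CV.
have [c hc] := Pol_lat hf.
pose m := \col_(i < N) mono (enum_val i) x.
pose cr := \row_(i < N) c (enum_val i).
have fx : f x = (cr *m m) 0 0.
  rewrite hc sumE mxE; apply: eq_bigr => i _; by rewrite !mxE.
have fn i : f (node T (enum_val i)) = (cr *m V) 0 i.
  rewrite hc sumE mxE; apply: eq_bigr => j _; by rewrite !mxE.
have bx i : basis T (enum_val i) x = (C *m m) i 0.
  rewrite (svalP (cB (enum_val i))) sumE mxE; apply: eq_bigr => j _; by rewrite !mxE.
rewrite /interp sumE.
under eq_bigr => i _ do rewrite fn bx.
rewrite fx -[cr *m m]/(_) -{2}[cr]mulmx1 -VC mulmxA -mulmxA mxE.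
by [].
Qed.

End Interpolation.

(** * Interpolation on edges *)

Section EdgeInterpolation.
Context {R : realType} (M : mesh R) (e : edge M).
Hypothesis e_neq0 : sb e.1 - sa e.1 != 0.
Implicit Types (f : R * R -> R) (n : nat) (t : R).

Lemma ecoord_side_pt t : ecoord e (side_pt e.1 t) = t.
Proof.
rewrite /ecoord /side_pt; set w := sb e.1 - sa e.1.
have w0 : dot w w != 0 by rewrite dot_eq0.
have -> : dot (sa e.1 + t *: w - sa e.1) w = t * dot w w.
  by rewrite /dot !planeE; ring.
by rewrite mulfK.
Qed.

Definition enode_coord n (j : 'I_n) : R := if n == 1 then 2^-1 else j%:R / n.-1%:R.

Lemma enode_coord01 n (j : 'I_n) : 0 <= enode_coord j <= 1.
Proof.
rewrite /enode_coord; case: ifP => [_|n1].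
  by apply/andP; split; lra.
have n0 : (0 < n.-1)%N by case: n n1 j => [|[|n]] // _ [].
rewrite divr_ge0 //= ler_pdivrMr ?ltr0n // mul1r ler_nat.
by rewrite -ltnS prednK ?ltn_ord // (leq_ltn_trans _ (ltn_ord j)).
Qed.

Definition ebasis_poly n (j : 'I_n) : {poly R} :=
  \prod_(l < n | l != j) ((n.-1%:R *: 'X - l%:R%:P) * ((j%:R - l%:R)^-1)%:P).

Lemma ebasis_polyE n (j : 'I_n) t : ebasis e j (side_pt e.1 t) = (ebasis_poly j).[t].
Proof.
rewrite /ebasis /ebasis_poly horner_prod ecoord_side_pt; apply: eq_bigr => l _.
by rewrite hornerM !hornerE.
Qed.

Lemma size_ebasis_poly n (j : 'I_n) : (size (ebasis_poly j) <= n)%N.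
Proof.
apply: leq_trans (size_prod_leq _ _) _; rewrite leq_subLR.
have h (l : 'I_n) :
    (size (((n.-1%:R *: 'X - l%:R%:P) * ((j%:R - l%:R)^-1)%:P)%R : {poly R}) <= 2)%N.
  apply: leq_trans (size_polyMleq _ _) _.
  have h1 : (size ((n.-1%:R *: 'X - l%:R%:P)%R : {poly R}) <= 2)%N.
    apply: leq_trans (size_polyD _ _) _; rewrite geq_max size_polyN.
    by rewrite (leq_trans (size_scale_leq _ _)) ?size_polyX ?(leq_trans (size_polyC_leq1 _)).
  have := @size_polyC_leq1 R ((j%:R - l%:R)^-1 : R).
  by move: h1; set a := size _; set b := size _; lia.
have c : #|[pred l | l != j]| = n.-1.
  by have := cardC1 j; rewrite card_ord.
apply: (@leq_trans (\sum_(l < n | l != j) 2).+1).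
  by rewrite ltnS; apply: leq_sum => l _; exact: h.
rewrite sum_nat_const c.
have := ltn_ord j; lia.
Qed.

Lemma ebasis_PolE n (j : 'I_n) (c : R) : PolE n e (fun x => c * ebasis e j x).
Proof.
exists (c *: ebasis_poly j); split.
  exact: leq_trans (size_scale_leq _ _) (size_ebasis_poly j).
by move=> t _; rewrite -/(side_pt e.1 t) ebasis_polyE hornerZ.
Qed.

Lemma ebasis_coord n (j j' : 'I_n) : (ebasis_poly j).[enode_coord j'] = (j == j')%:R.
Proof.
rewrite -ebasis_polyE -[side_pt _ _]/(enode e j') ebasis_enode //.
by move: e_neq0; rewrite subr_eq0 eq_sym.
Qed.

(** The interpolation error is a polynomial of degree less than n with n roots. *)
Lemma einterp_id n f : PolE n e f -> forall t, 0 <= t <= 1 ->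
  einterp e n f (side_pt e.1 t) = f (side_pt e.1 t).
Proof.
move=> [q [sq hq]] t t01; rewrite /einterp.
have fn (j : 'I_n) : f (enode e j) = q.[enode_coord j].
  by rewrite -[enode e j]/(side_pt e.1 (enode_coord j)) /side_pt hq // enode_coord01.
rewrite [RHS]hq //; pose P := q - \sum_(j < n) q.[enode_coord j] *: ebasis_poly j.
suff P0 : P = 0.
  move/eqP: P0; rewrite subr_eq0 => /eqP E.
  rewrite [in RHS]E horner_sum; apply: eq_bigr => j _.
  by rewrite fn ebasis_polyE hornerZ.
apply/eqP/negPn/negP => P0.
have := @max_poly_roots _ P [seq enode_coord j | j <- enum 'I_n] P0.
have -> : all (root P) [seq enode_coord j | j <- enum 'I_n].
  apply/allP => _ /mapP[j _ ->]; rewrite /root /P !hornerE horner_sum (bigD1 j) //=.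
  rewrite hornerZ ebasis_coord eqxx mulr1 big1 ?addr0 ?subrr // => i ij.
  by rewrite hornerZ ebasis_coord (negPf ij) mulr0.
have -> : uniq [seq enode_coord j | j <- enum 'I_n].
  rewrite map_inj_uniq ?enum_uniq // => i j ij.
  have := ebasis_coord i j; rewrite -ij ebasis_coord eqxx.
  by case: eqP => // _ /eqP; rewrite oner_eq0.
move=> /(_ isT isT); rewrite size_map size_enum_ord ltnNge => /negP; apply.
apply: leq_trans (size_polyD _ _) _; rewrite geq_max sq size_polyN /=.
apply: leq_trans (size_sum _ _ _) _; apply/bigmax_leqP => j _.
exact: leq_trans (size_scale_leq _ _) (size_ebasis_poly j).
Qed.

End EdgeInterpolation.

(** * Dual norms in the plane *)

Section PlaneNorms.
Context {R : realType}.
Implicit Types (x d : R * R) (s : \bar R) (c q : R).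

Lemma lnorm1E x : lnorm 1%E x = `|x.1| + `|x.2|.
Proof. by rewrite /lnorm invr1 !powRr1 ?addr_ge0. Qed.

Lemma lnorm_ge0 s x : 0 <= lnorm s x.
Proof.
by rewrite /lnorm; case: s => [q||]; rewrite ?powR_ge0 // le_max normr_ge0.
Qed.

Lemma lnormZ s c x : (1 <= s)%E -> 0 <= c -> lnorm s (c *: x) = c * lnorm s x.
Proof.
case: s => [q||] // s1 c0; rewrite /lnorm !planeE !normrM (ger0_norm c0).
  have q1 : 1 <= q by rewrite -lee_fin.
  have q0 : q != 0 by rewrite gt_eqF // (lt_le_trans _ q1).
  rewrite !powRM ?normr_ge0 // -mulrDr powRM ?powR_ge0 ?addr_ge0 ?powR_ge0 //.
  by rewrite -powRrM divff // powRr1.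
by rewrite maxr_pMr.
Qed.

Lemma lnorm_gt0 s x : (1 <= s)%E -> x != 0 -> 0 < lnorm s x.
Proof.
case: s => [q||] // s1; rewrite /lnorm.
  move=> x0; rewrite lt_neqAle powR_ge0 andbT eq_sym powR_eq0 negb_and; apply/orP; left.
  have q1 : 1 <= q by rewrite -lee_fin.
  have q0 : q != 0 by rewrite gt_eqF // (lt_le_trans _ q1).
  rewrite paddr_eq0 ?powR_ge0 // !powR_eq0 q0 !andbT !normr_eq0.
  by apply: contra x0 => /andP[/eqP h1 /eqP h2]; apply/eqP/injective_projections.
move=> x0; rewrite lt_max !normr_gt0 -negb_and.
by apply: contra x0 => /andP[/eqP h1 /eqP h2]; apply/eqP/injective_projections.
Qed.

Lemma conjugate_fin q : 1 < q -> hoelder_conjugate q%:E = (q / (q - 1))%:E.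
Proof.
move=> q1; rewrite /hoelder_conjugate /= eqe gt_eqF ?(lt_trans _ q1) //.
by rewrite -EFinB inver subr_eq0 (gt_eqF q1) -EFinM.
Qed.

Lemma lnorm_hoelder s x d : (1 <= s)%E ->
  dot x d <= lnorm (hoelder_conjugate s) x * lnorm s d.
Proof.
move=> s1; have dn : dot x d <= `|x.1| * `|d.1| + `|x.2| * `|d.2|.
  by rewrite /dot -!normrM lerD ?ler_norm.
apply: le_trans dn _; case: s s1 => [q||] // s1.
  have q1 : 1 <= q by rewrite -lee_fin.
  have [<-|q1'] := eqVneq 1 q.
    rewrite hoelder_conjugate1 lnorm1E /lnorm mulrDr.
    by rewrite lerD // ler_wpM2r // le_max lexx ?orbT.
  have {q1'} q1 : 1 < q by rewrite lt_neqAle q1'.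
  rewrite conjugate_fin //; apply: hoelder2 => //.
  - by rewrite divr_gt0 ?subr_gt0 // (lt_trans _ q1).
  - by rewrite (lt_trans _ q1).
  - by rewrite invf_div; field; move: q1; lra.
rewrite hoelder_conjugatey lnorm1E /lnorm mulrDl.
by rewrite lerD // ler_wpM2l // le_max lexx ?orbT.
Qed.

(** The Hoelder inequality is sharp: equality holds for the vector with entries
    sg x_i |x_i|^(p - 1), where p is the conjugate exponent. For negative c a vector
    with nonnegative product with x suffices. *)
Lemma lnorm_dual s x c : (1 <= s)%E -> c < lnorm (hoelder_conjugate s) x ->
  exists d, c * lnorm s d < dot x d.
Proof.
move=> s1 cN; have [c0|c0] := ltP c 0.
  exists ((-1) ^+ (x.1 < 0)%R, 0).
  rewrite (@lt_le_trans _ _ 0) ?nmulr_rlt0 ?lnorm_gt0 //.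
    by rewrite xpair_eqE signr_eq0.
  by rewrite /dot /= mulr0 addr0 mulrC -normrEsign.
case: s s1 cN => [q||] // s1.
  have q1 : 1 <= q by rewrite -lee_fin.
  have [<-|q1'] := eqVneq 1 q.
    rewrite hoelder_conjugate1 -[X in X -> _]/(is_true (c < Num.max _ _)) => cN.
    have sg1 (y : R) : c * `|Num.sg y| <= c.
      by rewrite -[X in _ <= X]mulr1 ler_wpM2l // normr_sg; case: (_ != 0).
    move: cN; rewrite lt_max => /orP[] h; [exists (Num.sg x.1, 0)|exists (0, Num.sg x.2)];
      rewrite lnorm1E /dot /= normr0 mulr0 ?addr0 ?add0r;
      by rewrite (le_lt_trans (sg1 _)) // mulrC -normrEsg.
  have {q1'} q1 : 1 < q by rewrite lt_neqAle q1'.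
  rewrite conjugate_fin // /lnorm; set p := q / (q - 1).
  have p1 : 1 < p by rewrite /p ltr_pdivlMr ?subr_gt0 // mul1r; move: q1; lra.
  set S := `|x.1| `^ p + `|x.2| `^ p => cN.
  have S0 : 0 < S.
    rewrite lt_neqAle addr_ge0 ?powR_ge0 // andbT eq_sym; apply: contraTneq cN => ->.
    rewrite powR0 ?invr_eq0 ?gt_eqF ?(lt_trans _ p1) //; last by rewrite -leNgt.
  have pq : (p - 1) * q = p by rewrite /p; field; move: q1; lra.
  have ab (y : R) : `|Num.sg y * `|y| `^ (p - 1)| `^ q = `|y| `^ p.
    have [->|y0] := eqVneq y 0.
      rewrite normr0 sgr0 mul0r normr0 !powR0 ?gt_eqF ?(lt_trans _ q1) ?(lt_trans _ p1) //.
    by rewrite normrM normr_sg y0 mul1r ger0_norm ?powR_ge0 // -powRrM pq.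
  have ad (y : R) : y * (Num.sg y * `|y| `^ (p - 1)) = `|y| `^ p.
    have [->|y0] := eqVneq y 0.
      by rewrite mul0r normr0 powR0 // gt_eqF ?(lt_trans _ p1).
    rewrite mulrA (mulrC y) -normrEsg -{1}[`|y|]powRr1 // -powRD ?normr_eq0 ?y0 ?implybT //.
    by rewrite addrC subrK.
  exists (Num.sg x.1 * `|x.1| `^ (p - 1), Num.sg x.2 * `|x.2| `^ (p - 1)).
  rewrite /dot /= !ab !ad -/S.
  have pq1 : p^-1 + q^-1 = 1 by rewrite /p invf_div; field; move: q1; lra.
  have ES : S `^ p^-1 * S `^ q^-1 = S.
    rewrite -powRD; last by rewrite (gt_eqF S0) implybT.
    by rewrite pq1 powRr1 // ltW.
  rewrite -[X in _ < X]ES.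
  by rewrite ltr_pM2r // powR_gt0.
rewrite hoelder_conjugatey lnorm1E => cN.
exists (Num.sg x.1, Num.sg x.2).
rewrite /dot /= !(mulrC _ (Num.sg _)) -!normrEsg (le_lt_trans _ cN) //.
rewrite -[X in _ <= X]mulr1 ler_wpM2l // /lnorm ge_max !normr_sg.
by case: (x.1 != 0); case: (x.2 != 0); rewrite /= ?lexx ?ler01.
Qed.

End PlaneNorms.

(** * Quadrature and conjugate functions *)

Section Quadrature.
Context {R : realType} (M : mesh R).
Local Notation cell := 'I_(ntri M).
Local Notation basis := Defs.basis.
Implicit Types (T : cell) (f g h : R * R -> R) (n : nat).

Lemma intT_sum T (I : Type) (r : seq I) (F : I -> R * R -> R) :
  (forall i, continuous (F i)) ->
  intT T (fun x => \sum_(i <- r) F i x) = \sum_(i <- r) intT T (F i).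
Proof.
move=> cF; elim: r => [|i r IHr].
  rewrite big_nil /intT; under eq_Rintegral do rewrite big_nil.
  by rewrite Rintegral_cst ?mul0r //; apply: compact_measurable_plane; exact: tri_compact.
rewrite big_cons -IHr -intTD //; last by move=> x; apply: cvg_sumr => j _; exact: cF.
by apply: eq_Rintegral => t _; rewrite big_cons.
Qed.

Lemma basis_continuous T n (k : lat n) : tdet T != 0 -> continuous (basis T k).
Proof. by move=> d0; apply/C1_continuous/Pol_C1; exact: basis_Pol. Qed.

Lemma intT_mul_interp T n h g : tdet T != 0 -> continuous h ->
  intT T (fun x => h x * interp T n g x) =
  \sum_(k : lat n) g (node T k) * intT T (fun x => h x * basis T k x).
Proof.
move=> d0 ch.
rewrite (_ : (fun x => _) =
    fun x => \sum_(k : lat n) g (node T k) * (h x * basis T k x)); last first.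
  by apply/funext => x; rewrite /interp mulr_sumr; apply: eq_bigr => k _; rewrite mulrCA.
have ck (k : lat n) : continuous (fun x => h x * basis T k x).
  by move=> x; apply: cvgM; [exact: ch|exact: basis_continuous].
rewrite intT_sum => [|k x]; last by apply: cvgM; [exact: cvg_cst|exact: ck].
by apply: eq_bigr => k _; rewrite intTZ.
Qed.

Lemma intT_interp T n g : tdet T != 0 ->
  intT T (interp T n g) = \sum_(k : lat n) g (node T k) * wT T k.
Proof.
move=> d0; transitivity (intT T (fun x => 1 * interp T n g x)).
  by apply: eq_Rintegral => x _; rewrite mul1r.
rewrite (intT_mul_interp n g d0 (@continuous_cst R 1)).
by apply: eq_bigr => k _; congr (_ * _); apply: eq_Rintegral => x _; rewrite mul1r.
Qed.

Lemma C1_prod (I : Type) (r : seq I) (P : pred I) (F : I -> R * R -> R) :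
  (forall i, C1 (F i)) -> C1 (fun x => \prod_(i <- r | P i) F i x).
Proof.
move=> hF; elim: r => [|i r IHr].
  by apply: C1_ext (C1_cst 1) => x; rewrite big_nil.
have [Pi|Pi] := boolP (P i).
  by apply: C1_ext (C1M (hF i) IHr) => x; rewrite big_cons Pi.
by apply: C1_ext IHr => x; rewrite big_cons (negPf Pi).
Qed.

Lemma ebasis_continuous (e : edge M) n (j : 'I_n) : continuous (ebasis e j).
Proof.
apply/C1_continuous/C1_prod => l; apply: C1M; last exact: C1_cst.
apply: C1D; last exact: C1_cst; apply: C1M; first exact: C1_cst.
rewrite /ecoord; apply: C1M; last exact: C1_cst.
rewrite /dot; apply: C1D; apply: C1M; try exact: C1_cst.
  by apply: C1_ext (C1D C1_fst (C1_cst (- (sa e.1).1))) => x; rewrite !planeE.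
by apply: C1_ext (C1D C1_snd (C1_cst (- (sa e.1).2))) => x; rewrite !planeE.
Qed.

Lemma intE_mul_einterp (e : edge M) n h g : continuous h ->
  intE e (fun x => h x * einterp e n g x) =
  \sum_(j < n) g (enode e j) * intE e (fun x => ebasis e j x * h x).
Proof.
move=> ch.
rewrite (_ : (fun x => _) =
    fun x => \sum_(j < n) g (enode e j) * (ebasis e j x * h x)); last first.
  apply/funext => x; rewrite /einterp mulr_sumr; apply: eq_bigr => k _.
  by rewrite mulrCA (mulrC (h x)).
have ck (j : 'I_n) : continuous (fun x => ebasis e j x * h x).
  by move=> x; apply: cvgM; [exact: ebasis_continuous|exact: ch].
rewrite /intE lineintE mean_sum => [|k x]; last by apply: cvgM; [exact: cvg_cst|exact: ck].
rewrite mulr_sumr; apply: eq_bigr => k _.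
by rewrite meanZ // mulrCA.
Qed.

Lemma intE_einterp (e : edge M) n g :
  intE e (einterp e n g) = \sum_(j < n) g (enode e j) * wE e j.
Proof.
have := intE_mul_einterp e n g (@continuous_cst R 1).
rewrite /intE !lineintE => H.
transitivity (enorm (sb e.1 - sa e.1) *
    mean (sa e.1) (sb e.1) (fun x => 1 * einterp e n g x)).
  by congr (_ * _); apply: eq_Rintegral => t _; rewrite mul1r.
rewrite H; apply: eq_bigr => j _; congr (_ * _).
by rewrite /wE /intE !lineintE; congr (_ * _); apply: eq_Rintegral => t _; rewrite mulr1.
Qed.

End Quadrature.

Section Conjugates.
Context {R : realType}.

Lemma fconj_ge (V : Type) (A : set V) (F xi : V -> R) v : A v ->
  ((xi v - F v)%:E <= fconj A F xi)%E.
Proof. by move=> Av; apply: ereal_sup_ubound; exists v. Qed.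

Lemma fconj_max (V : Type) (A : set V) (F xi : V -> R) v : A v ->
  (forall w, A w -> xi w - F w <= xi v - F v) -> fconj A F xi = (xi v - F v)%:E.
Proof.
move=> Av h; apply/eqP; rewrite eq_le fconj_ge // andbT.
by apply: ge_ereal_sup => _ [w Aw <-]; rewrite lee_fin; exact: h.
Qed.

(** The hypothesis provides a ray on which xi - F grows linearly. *)
Lemma fconj_unbounded (V : Type) (A : set V) (F xi : V -> R) (a b : R) : 0 < b ->
  (forall l, 0 <= l -> exists2 v, A v & xi v - F v = a + l * b) ->
  fconj A F xi = +oo%E.
Proof.
move=> b0 h; have H l : 0 <= l -> ((a + l * b)%:E <= fconj A F xi)%E.
  by move=> /h[v Av <-]; exact: fconj_ge.
move: H; case: (fconj A F xi) => [r|//|] H; last by have := H 0 (lexx _); rewrite leeNy_eq.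
have := H (Num.max 0 ((r - a) / b + 1)); rewrite le_max lexx lee_fin => /(_ isT).
have : (r - a) / b + 1 <= Num.max 0 ((r - a) / b + 1) by rewrite le_max lexx orbT.
set m := Num.max _ _ => h1 h2.
have h3 : ((r - a) / b + 1) * b <= m * b by rewrite ler_pM2r.
by move: h3; rewrite mulrDl mul1r divfK ?gt_eqF // => h3; exfalso; move: b0 h2 h3; lra.
Qed.

End Conjugates.

(** * The two conjugates of the dual objective *)

Section Duality.
Context {R : realType} (Omega : set (R * R)) (M : mesh R).
Local Notation cell := 'I_(ntri M).
Local Notation basis := Defs.basis.
Variables (D0 : {set cell}) (nE : edge M -> R * R).
Variables (r : nat) (s : \bar R) (beta : R) (f : cell -> R * R -> R).
Hypothesis Omega_open : open Omega.
Hypothesis Omega_bounded : bounded_set Omega.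
Hypothesis meshO : triangulates M Omega.
Hypothesis nE_normal : edge_normals Omega nE.
Hypothesis s1 : (1 <= s)%E.
Hypothesis f_Pol : DGon D0 r.+1 f.

Lemma primal_objE u : primal_obj Omega D0 nE r s beta f u
  = fidelity D0 r f u + beta * Gfun Omega nE r s (Lam nE u).
Proof.
rewrite /primal_obj /DTV /Gfun; congr (_ + _ * (_ + _)); apply: eq_bigr => e _.
rewrite !intE_einterp mulr_sumr; apply: eq_bigr => j _.
by rewrite -mulrA mulrCA.
Qed.

Section FixedField.
Variable p : cell -> R * R -> R * R.
Hypothesis p_RT0 : RT0 r.+1 Omega p.

Let p_C1 T : C1 (fun x => (p T x).1) /\ C1 (fun x => (p T x).2).
Proof. by have [[h _] _] := p_RT0; exact: RTloc_C1 (h T). Qed.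

(** Extending the weights and the data by zero to the triangles outside Omega_0
    treats both kinds of constraints on div p at once: a weight zero forces the
    moment to vanish. *)
Definition fid_weight T (k : lat r.+1) : R := if T \in D0 then wT T k else 0.

Definition data_ext T : R * R -> R := if T \in D0 then f T else fun=> 0.

Lemma data_ext_DG : DG r.+1 data_ext.
Proof. by move=> T; rewrite /data_ext; case: ifP => [/f_Pol//|_]; exact: Pol0. Qed.

Lemma int_div_nodal T g : Pol r.+1 g ->
  intT T (fun x => divergence (p T) x * g x) =
  \sum_(k : lat r.+1) div_int p T k * g (node T k).
Proof.
move=> hg; have d0 := tdet_neq0 meshO T.
have -> : g = interp T r.+1 g by apply/funext => x; rewrite interp_id.
rewrite intT_mul_interp //; last exact: divergence_continuous.
by apply: eq_bigr => k _; rewrite mulrC (interp_id d0 hg).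
Qed.

(** By integration by parts and exactness of interpolation the problem of the
    first conjugate separates into one-dimensional problems at the nodes. *)
Lemma fidelity_nodal u : DG r.+1 u ->
  - pairing Omega nE p (Lam nE u) - fidelity D0 r f u =
  \sum_T \sum_(k : lat r.+1) (div_int p T k * u T (node T k)
    - fid_weight T k * `|u T (node T k) - data_ext T (node T k)|).
Proof.
move=> hu.
rewrite (pairing_Lam Omega_open Omega_bounded meshO nE_normal p_RT0 (fun T => Pol_C1 (hu T))).
rewrite /fidelity [X in _ - X]big_mkcond -sumrB; apply: eq_bigr => T _.
rewrite int_div_nodal // big_split /= sumrN; congr (_ - _).
rewrite /fid_weight /data_ext; case: ifP => _; last first.
  by rewrite big1 // => k _; rewrite mul0r.
by rewrite intT_interp ?(tdet_neq0 meshO) //; apply: eq_bigr => k _; rewrite mulrC.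
Qed.

Lemma dual_J_nodal : dual_J D0 f p =
  \sum_T \sum_(k : lat r.+1) div_int p T k * data_ext T (node T k).
Proof.
rewrite /dual_J big_mkcond; apply: eq_bigr => T _; rewrite /data_ext.
case: ifP => TD; first by rewrite int_div_nodal //; exact: f_Pol.
by rewrite big1 // => k _; rewrite mulr0.
Qed.

Lemma fidelity_data :
  - pairing Omega nE p (Lam nE data_ext) - fidelity D0 r f data_ext = dual_J D0 f p.
Proof.
rewrite fidelity_nodal ?dual_J_nodal; last exact: data_ext_DG.
apply: eq_bigr => T _; apply: eq_bigr => k _.
by rewrite subrr normr0 mulr0 subr0.
Qed.

Let Fconj := fconj [set u | DG r.+1 u] (fidelity D0 r f)
  (fun u => - pairing Omega nE p (Lam nE u)).
Let Gconj := fconj [set d | Yspace Omega r d]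
  (fun d => beta * Gfun Omega nE r s d) (pairing Omega nE p).

Lemma Fconj_feasible : (forall T (k : lat r.+1), `|div_int p T k| <= fid_weight T k) ->
  Fconj = (dual_J D0 f p)%:E.
Proof.
move=> h; rewrite /Fconj -fidelity_data.
apply: (fconj_max (v := data_ext)); first exact: data_ext_DG.
move=> u hu; suff le : \sum_T \sum_(k : lat r.+1) (div_int p T k * u T (node T k)
    - fid_weight T k * `|u T (node T k) - data_ext T (node T k)|) <= dual_J D0 f p.
  by rewrite -(fidelity_nodal hu) -fidelity_data in le.
rewrite dual_J_nodal; apply: ler_sum => T _; apply: ler_sum => k _.
rewrite lerBlDl -lerBlDr -mulrBr.
apply: le_trans (ler_norm _) _; rewrite normrM.
by rewrite ler_wpM2r.
Qed.

Lemma Fconj_ge : ((dual_J D0 f p)%:E <= Fconj)%E.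
Proof.
rewrite /Fconj -fidelity_data.
by apply: (@fconj_ge _ _ _ _ _ data_ext); exact: data_ext_DG.
Qed.

Lemma sum_delta (I J : finType) (i : I) (j : J) (G : I -> J -> R) (c : R) :
  \sum_i' \sum_j' (G i' j' + (if (i' == i) && (j' == j) then c else 0)) =
  \sum_i' \sum_j' G i' j' + c.
Proof.
rewrite !pair_big big_split /=; congr (_ + _).
by rewrite -big_mkcond (big_pred1 (i, j)) // => -[].
Qed.

(** A large multiple of a single basis function is added to the data. *)
Lemma Fconj_infeasible T (k : lat r.+1) : fid_weight T k < `|div_int p T k| -> Fconj = +oo%E.
Proof.
rewrite -subr_gt0 => h; apply: (fconj_unbounded (a := dual_J D0 f p) h) => l l0.
pose v : R := (-1) ^+ (div_int p T k < 0)%R.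
pose u T' x := data_ext T' x + (if T' == T then l * v * basis T' k x else 0).
have hu : DG r.+1 u.
  move=> T'; apply: PolD; first exact: data_ext_DG.
  case: eqP => _; last exact: Pol0.
  by apply: PolZ; apply: basis_Pol; exact: (tdet_neq0 meshO).
exists u => //; rewrite fidelity_nodal // dual_J_nodal.
rewrite -(sum_delta T k); apply: eq_bigr => T' _; apply: eq_bigr => k' _.
have -> : u T' (node T' k') - data_ext T' (node T' k') =
    if (T' == T) && (k' == k) then l * v else 0.
  rewrite /u [X in X - _]addrC addrK; case: eqP => //= _.
  rewrite basis_node ?(tdet_neq0 meshO) // (eq_sym k).
  by case: eqP; rewrite ?mulr1 ?mulr0.
have -> : u T' (node T' k') = data_ext T' (node T' k') +
    if (T' == T) && (k' == k) then l * v else 0.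
  rewrite /u; congr (_ + _); case: eqP => //= _.
  rewrite basis_node ?(tdet_neq0 meshO) // (eq_sym k).
  by case: eqP; rewrite ?mulr1 ?mulr0.
case: andP => [[/eqP -> /eqP ->]|_]; last by rewrite normr0 !addr0 mulr0 subr0.
rewrite mulrDr -addrA; congr (_ + _).
rewrite normrM normr_sign mulr1 ger0_norm // mulrBr; congr (_ - _); last by rewrite mulrC.
by rewrite mulrCA (mulrC _ v) -normrEsign.
Qed.

(** The degrees of freedom of p are the coefficients of the nodal values of d. *)
Lemma pairing_nodal d : Yspace Omega r d ->
  pairing Omega nE p d - beta * Gfun Omega nE r s d =
  \sum_T \sum_(k : lat r) (dot (sigmaT p T k) (d.1 T (node T k))
     - beta * wT T k * lnorm s (d.1 T (node T k))) +
  \sum_(e in iedges M Omega) \sum_(j < r.+1) (- sigmaE nE p e j * d.2 e (enode e j)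
     - beta * lnorm s (nE e) * wE e j * `|d.2 e (enode e j)|).
Proof.
move=> [hT hE]; rewrite /pairing /Gfun mulrDr opprD addrACA; congr (_ + _).
  rewrite mulr_sumr -sumrB; apply: eq_bigr => T _.
  have d0 := tdet_neq0 meshO T; have [h1 h2] := hT T.
  rewrite intT_interp // sumrB; congr (_ - _); last first.
    by rewrite mulr_sumr; apply: eq_bigr => k _; rewrite -mulrA (mulrC (wT _ _)).
  rewrite (_ : (fun x => _) = fun x => (p T x).1 * interp T r (fun x => (d.1 T x).1) x +
    (p T x).2 * interp T r (fun x => (d.1 T x).2) x); last first.
    by apply/funext => x; rewrite !interp_id.
  have [c1 c2] := p_C1 T.
  rewrite intTD; last 2 first.
  - move=> x; apply: cvgM; first exact: (C1_continuous c1).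
    rewrite (_ : interp _ _ _ = (fun x => (d.1 T x).1)); first exact: (C1_continuous (Pol_C1 h1)).
    by apply/funext => y; rewrite interp_id.
  - move=> x; apply: cvgM; first exact: (C1_continuous c2).
    rewrite (_ : interp _ _ _ = (fun x => (d.1 T x).2)); first exact: (C1_continuous (Pol_C1 h2)).
    by apply/funext => y; rewrite interp_id.
  rewrite !intT_mul_interp //; [|exact: C1_continuous..].
  rewrite -big_split /=; apply: eq_bigr => k _; rewrite /sigmaT /dot /= !(mulrC (intT _ _)).
  by congr (_ * _ + _ * _); apply: eq_Rintegral => x _; rewrite mulrC.
rewrite mulr_sumr -opprD -big_split -sumrN /=; apply: eq_bigr => e eI.
have e0 : sb e.1 - sa e.1 != 0 by exact: (sa_neq_sb meshO).
have cn : continuous (ntrace nE p e).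
  have [h1 h2] := p_C1 e.1.1; apply: C1_continuous; rewrite /ntrace /dot.
  by apply: C1D; apply: C1M; [exact: h1|exact: C1_cst|exact: h2|exact: C1_cst].
rewrite intE_einterp.
have -> : intE e (fun x => ntrace nE p e x * d.2 e x) =
    intE e (fun x => ntrace nE p e x * einterp e r.+1 (d.2 e) x).
  rewrite /intE !lineintE; congr (_ * _); apply: eq_Rintegral => t.
  rewrite inE /= in_itv /= => t01.
  by rewrite -/(side_pt e.1 t) (einterp_id e0 (hE e eI)).
rewrite intE_mul_einterp // mulrA mulr_sumr -big_split -sumrN.
apply: eq_bigr => j _; rewrite /sigmaE /= opprD; congr (_ + _).
  by rewrite mulrC mulNr.
by congr (- _); rewrite -[RHS]mulrA (mulrC (wE _ _)).
Qed.

Lemma lnorm0 : lnorm s 0 = 0.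
Proof. by rewrite -(scale0r (0 : R * R)) lnormZ // mul0r. Qed.

Definition dual_zero : dual_data M := (fun=> fun=> 0, fun=> fun=> 0).

Lemma Yspace0 : Yspace Omega r dual_zero.
Proof.
split=> [T|e _]; first by split; exact: Pol0.
by exists 0; split=> [|t _]; rewrite ?size_poly0 ?horner0.
Qed.

Lemma pairing_zero :
  pairing Omega nE p dual_zero - beta * Gfun Omega nE r s dual_zero = 0.
Proof.
rewrite pairing_nodal; last exact: Yspace0.
rewrite !big1 ?addr0 // => [e _|T _]; rewrite big1 // => k _ /=.
  by rewrite normr0 !mulr0 subr0.
by rewrite lnorm0 mulr0 subr0 /dot /= !mulr0 addr0.
Qed.

Lemma Gconj_feasible : betaP Omega nE r s beta p -> Gconj = 0%E.
Proof.
move=> [_ hT hE]; rewrite /Gconj -[0%E]/(0 : R)%:E -pairing_zero.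
apply: (fconj_max (v := dual_zero)).
  exact: Yspace0.
move=> d dY; rewrite pairing_zero pairing_nodal // -[X in _ <= X]addr0 lerD //.
  apply: sumr_le0 => T _; apply: sumr_le0 => k _; rewrite subr_le0.
  apply: le_trans (lnorm_hoelder _ _ s1) _.
  by rewrite ler_wpM2r ?lnorm_ge0.
apply: sumr_le0 => e eI; apply: sumr_le0 => j _; rewrite subr_le0.
apply: le_trans (ler_norm _) _; rewrite normrM normrN.
by rewrite ler_wpM2r // hE.
Qed.

Lemma Gconj_ge0 : (0 <= Gconj)%E.
Proof.
rewrite -[0%E]/(0 : R)%:E -pairing_zero.
by apply: (@fconj_ge _ _ _ _ _ dual_zero); exact: Yspace0.
Qed.

(** At a single node, d takes large multiples of a vector for which the Hoelder
    inequality fails with the constant beta c_{T,k}. *)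
Lemma Gconj_infeasibleT T (k : lat r) :
  beta * wT T k < lnorm (hoelder_conjugate s) (sigmaT p T k) -> Gconj = +oo%E.
Proof.
move=> /(lnorm_dual s1)[v]; rewrite -subr_gt0 => h.
apply: (fconj_unbounded (a := 0) h) => l l0.
pose d : dual_data M := (fun T' x => if T' == T then (l * basis T' k x) *: v else 0, fun=> fun=> 0).
have dY : Yspace Omega r d.
  split=> [T'|e _] /=; last by exists 0; split=> [|t _]; rewrite ?size_poly0 ?horner0.
  case: eqP => _; last by split; exact: Pol0.
  have hb := PolZ l (basis_Pol k (tdet_neq0 meshO T')).
  by split; [apply: Pol_ext (PolZ v.1 hb)|apply: Pol_ext (PolZ v.2 hb)] => x; rewrite !planeE mulrC.
exists d => //; rewrite pairing_nodal // [X in _ + X]big1 ?addr0; last first.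
  by move=> e _; rewrite big1 // => j _; rewrite /= normr0 !mulr0 subr0.
pose c := l * (dot (sigmaT p T k) v - beta * wT T k * lnorm s v).
transitivity (\sum_(T' : cell) \sum_(k' : lat r)
    (0 + if (T' == T) && (k' == k) then c else 0)); last first.
  by rewrite sum_delta big1 // => T' _; rewrite big1.
apply: eq_bigr => T' _; apply: eq_bigr => k' _.
rewrite add0r; have -> : d.1 T' (node T' k') = (if (T' == T) && (k' == k) then l else 0) *: v.
  rewrite /=; case: eqP => _ /=; last by rewrite scale0r.
  rewrite basis_node ?(tdet_neq0 meshO) // (eq_sym k).
  by case: eqP; rewrite ?mulr1 ?mulr0.
case: andP => [[/eqP -> /eqP ->]|_]; rewrite lnormZ //; last first.
  by rewrite mul0r mulr0 subr0 scale0r /dot /= !mulr0 addr0.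
by rewrite /c /dot !planeE; ring.
Qed.

Lemma Gconj_infeasibleE e (j : 'I_r.+1) : e \in iedges M Omega ->
  beta * lnorm s (nE e) * wE e j < `|sigmaE nE p e j| -> Gconj = +oo%E.
Proof.
move=> eI; rewrite -subr_gt0 => h.
apply: (fconj_unbounded (a := 0) h) => l l0.
pose v : R := - (-1) ^+ (sigmaE nE p e j < 0)%R.
pose d : dual_data M := (fun=> fun=> 0, fun e' x => if e' == e then (l * v) * ebasis e' j x else 0).
have dY : Yspace Omega r d.
  split=> [T'|e' _] /=; first by split; exact: Pol0.
  case: eqP => _; first by apply: ebasis_PolE; exact: (sa_neq_sb meshO).
  by exists 0; split=> [|t _]; rewrite ?size_poly0 ?horner0.
exists d => //; rewrite pairing_nodal // [X in X + _]big1 ?add0r; last first.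
  by move=> T _; rewrite big1 // => k _ /=; rewrite lnorm0 mulr0 subr0 /dot /= !mulr0 addr0.
rewrite (bigD1 e) //= [X in _ + X]big1 ?addr0; last first.
  move=> e' /andP[_ /negPf ne]; rewrite big1 // => i _.
  by rewrite ne normr0 !mulr0 subr0.
rewrite eqxx (bigD1 j) //= big1 ?addr0; last first.
  move=> i ij; rewrite ebasis_enode; last first.
    by have := sa_neq_sb meshO e.1; rewrite subr_eq0 eq_sym.
  by rewrite eq_sym (negPf ij) mulr0 normr0 !mulr0 subr0.
rewrite ebasis_enode; last by have := sa_neq_sb meshO e.1; rewrite subr_eq0 eq_sym.
rewrite eqxx mulr1 normrM normrN normr_sign mulr1 (ger0_norm l0) [in RHS]normrEsign /v.
move: (sigmaE _ _ _ _) (wE _ _) (lnorm _ _) => y w z; ring.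
Qed.

End FixedField.
End Duality.

Theorem theorem4p4 (R : realType) (Omega : set (R * R)) (M : mesh R)
    (D0 : {set 'I_(ntri M)}) (nE : edge M -> R * R)
    (r : nat) (s : \bar R) (beta : R) (f : 'I_(ntri M) -> R * R -> R) :
  open Omega -> connected Omega -> Omega !=set0 -> bounded_set Omega ->
  triangulates M Omega ->
  edge_normals Omega nE ->
  (r <= 3)%N -> (1 <= s)%E -> 0 < beta ->
  DGon D0 r.+1 f ->
  (forall u, DG r.+1 u ->
     primal_obj Omega D0 nE r s beta f u
     = fidelity D0 r f u + beta * Gfun Omega nE r s (Lam nE u)) /\
  (forall p, RT0 r.+1 Omega p ->
     (dual_feasible Omega D0 nE r s beta p ->
        dual_obj Omega D0 nE r s beta f p = (dual_J D0 f p)%:E) /\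
     (~ dual_feasible Omega D0 nE r s beta p ->
        dual_obj Omega D0 nE r s beta f p = +oo%E)).
Proof.
move=> Oo _ _ Ob mO nEn _ s1 _ fP; split=> [u _|p pRT]; first exact: primal_objE.
rewrite /dual_obj; split=> [[h1 h2 hP]|nfeas].
  rewrite (Fconj_feasible Oo Ob mO nEn fP pRT) ?(Gconj_feasible mO s1 pRT) ?adde0 //.
  move=> T k; rewrite /fid_weight; case: ifPn => TD; first exact: h1.
  by rewrite h2.
have Fge := Fconj_ge Oo Ob mO nEn fP pRT.
have Gge := @Gconj_ge0 _ Omega M nE r s beta mO s1 p pRT.
have [hF|/existsNP[T /existsNP[k /negP]]] :=
    pselect (forall T (k : lat r.+1), `|div_int p T k| <= fid_weight D0 T k); last first.
  rewrite -ltNge => hF; rewrite (Fconj_infeasible Oo Ob mO nEn fP pRT hF).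
  by rewrite addye // gt_eqF // (lt_le_trans _ Gge).
suff -> : fconj [set d | Yspace Omega r d] (fun d => beta * Gfun Omega nE r s d)
    (pairing Omega nE p) = +oo%E.
  by rewrite addey // gt_eqF // (lt_le_trans _ Fge) // ltNyr.
apply: contrapT => Gfin; apply: nfeas; split.
- by move=> T k TD; have := hF T k; rewrite /fid_weight TD.
- move=> T k /negPf TD; apply/eqP; rewrite eq_le normr_ge0 andbT.
  by have := hF T k; rewrite /fid_weight TD.
split=> // [T k|e j eI]; rewrite leNgt; apply/negP => h; apply: Gfin.
  exact: (Gconj_infeasibleT nE mO s1 pRT h).
exact: (Gconj_infeasibleE mO s1 pRT eI h).
Qed.
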